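(* Let $f$ be a transcendental entire function of finite order with only real zeros and genus at least $2$. Then (a) there exists $\theta\in[0,2\pi]$ such that $f(re^{i\theta})\to0$ as $r\to\infty$; (b) $0$ is a deficient value of $f$, that is, $\delta(0,f)>0$. Each of (a) and (b) implies that $m(r)\to0$ as $r\to\infty$, so there is no $r>0$ such that $m^n(r)\to\infty$ as $n\to\infty$.
   Context: For a transcendental entire function $f$, $M(r)=\max\{|f(z)|:|z|=r\}$, $m(r)=\min\{|f(z)|:|z|=r\}$ (with $m(0)=|f(0)|$), and $m^n$ denotes the $n$th iterate of $r\mapsto m(r)$. The order of $f$ is $\limsup_{r\to\infty}\frac{\log\log M(r)}{\log r}$. Genus: every finite order entire function has a Hadamard representation $f(z)=z^n e^{Q(z)}\prod_{k}E(z/a_k,m)$, where $n\ge0$ is an integer, $Q$ is a polynomial, the $a_k$ are the non-zero zeros of $f$ (repeated according to multiplicity), $E(z,0)=1-z$, $E(z,m)=(1-z)e^{z+z^2/2+\cdots+z^m/m}$ for $m\ge1$, and $m$ is the smallest non-negative integer for which $\sum_k|a_k|^{-(m+1)}$ converges. The genus of $f$ is $\max\{m,\deg Q\}$ (here $m$ is an integer, not the minimum modulus). Deficiency: let $n(t,f)$ be the number of zeros of $f$ in $\{z:|z|\le t\}$ counted according to multiplicity, $N(r)=\int_0^r\frac{n(t,f)-n(0,f)}{t}\,dt$, $\log^+t=\max\{\log t,0\}$, and $T(r)=N(r)+\frac1{2\pi}\int_0^{2\pi}\log^+(1/|f(re^{i\theta})|)\,d\theta$. The defect of $f$ at $0$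 is $\delta(0,f)=1-\limsup_{r\to\infty}\frac{N(r)}{T(r)}$, and $0$ is a deficient value of $f$ if $\delta(0,f)>0$. *)

(* Defs.v *)
From HB Require Import structures.
From mathcomp Require Export all_boot all_order all_algebra.
From mathcomp Require Export all_classical all_reals all_analysis.
From mathcomp Require Export complex.

Set Implicit Arguments.
Unset Strict Implicit.
Unset Printing Implicit Defensive.

Import Order.TTheory GRing.Theory Num.Theory.
Export numFieldNormedType.Exports.

Local Open Scope classical_set_scope.
Local Open Scope ring_scope.
Local Open Scope complex_scope.

Definition cmod (R : realType) (z : R[i]) : R := Normc.normc z.

Definition cexp (R : realType) (z : R[i]) : R[i] :=
  (expR (complex.Re z))%:C * (cos (complex.Im z) +i* sin (complex.Im z)).

Definition circle_point (R : realType) (r theta : R) : R[i] :=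
  r%:C * cexp (0 +i* theta).

(* R[i]^o is R[i] as a normed module over itself, so that derivability is
   complex differentiability. *)
Definition entire (R : realType) (f : R[i] -> R[i]) : Prop :=
  forall z : R[i], derivable (f : R[i]^o -> R[i]^o) z 1.

Definition transcendental_entire (R : realType) (f : R[i] -> R[i]) : Prop :=
  entire f /\ ~ (exists p : {poly R[i]}, forall z, f z = p.[z]).

(* For r >= 0 and f continuous, the circle |z| = r is compact and non-empty,
   so this supremum is a maximum and the infimum below is a minimum. *)
Definition max_modulus (R : realType) (f : R[i] -> R[i]) (r : R) : R :=
  sup [set cmod (f z) | z in [set z | cmod z = r]].

Definition min_modulus (R : realType) (f : R[i] -> R[i]) (r : R) : R :=
  inf [set cmod (f z) | z in [set z | cmod z = r]].

Definition growth_order (R : realType) (f : R[i] -> R[i]) : \bar R :=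
  limf_esup (fun r : R => (ln (ln (max_modulus f r)) / ln r)%:E)
            (pinfty_nbhs R).

Definition vanishing_order (R : realType) (f : R[i] -> R[i]) (z : R[i])
    (n : nat) : Prop :=
  exists g : R[i] -> R[i],
    [/\ entire g, g z <> 0 & forall w, f w = (w - z) ^+ n * g w].

(* An entire f that is not identically 0 has exactly one vanishing order at
   each z; it is 0 when f z is not 0. *)
Definition multiplicity (R : realType) (f : R[i] -> R[i]) (z : R[i]) : nat :=
  xget 0%N [set n | vanishing_order f z n].

Definition primary_factor (R : realType) (m : nat) (z : R[i]) : R[i] :=
  (1 - z) * cexp (\sum_(1 <= j < m.+1) z ^+ j / j%:R).

(* The non-zero zeros of f are the a k with k in K, K being any set of
   indices: this covers finitely many zeros (possibly none) as well as
   infinitely many. *)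
Definition enumerates_nonzero_zeros (R : realType) (f : R[i] -> R[i])
    (K : set nat) (a : nat -> R[i]) : Prop :=
  (forall k, K k -> a k <> 0) /\
  (forall z : R[i], z <> 0 -> ([set k | K k /\ a k = z] #= `I_(multiplicity f z))%card).

Definition inverse_power_summable (R : realType) (K : set nat)
    (a : nat -> R[i]) (p : nat) : Prop :=
  summable K (fun k => ((cmod (a k))^-1 ^+ p)%:E).

Definition hadamard_representation (R : realType) (f : R[i] -> R[i])
    (n : nat) (Q : {poly R[i]}) (K : set nat) (a : nat -> R[i]) (m : nat)
    : Prop :=
  [/\ enumerates_nonzero_zeros f K a,
      inverse_power_summable K a m.+1,
      forall j, inverse_power_summable K a j.+1 -> (m <= j)%N
    & forall z, (fun N : nat =>
        z ^+ n * cexp Q.[z]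
          * \prod_(0 <= k < N | k \in K) primary_factor m (z / a k))
        @ \oo --> (f z : R[i]^o)].

(* The value of max m (deg Q) does not depend on the representation; the
   degree of Q is (size Q).-1. *)
Definition genus (R : realType) (f : R[i] -> R[i]) : nat :=
  xget 0%N [set g | exists n Q K a m,
    hadamard_representation f n Q K a m /\ g = maxn m (size Q).-1].

Definition zero_count (R : realType) (f : R[i] -> R[i]) (t : R) : \bar R :=
  \esum_(z in [set z | f z = 0 /\ cmod z <= t]) (multiplicity f z)%:R%:E.

Definition counting_N (R : realType) (f : R[i] -> R[i]) (r : R) : \bar R :=
  (\int[lebesgue_measure]_(t in `[0%R, r])
     ((zero_count f t - zero_count f 0%R) / t%:E))%E.

(* Extended-real valued, so that logplus +oo = +oo: this is the value of
   log^+ (1/|f|) at the zeros of f. *)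
Definition logplus (R : realType) (x : \bar R) : \bar R := maxe (lne x) 0%E.

Definition characteristic_T (R : realType) (f : R[i] -> R[i]) (r : R)
    : \bar R :=
  (counting_N f r + ((2 * pi)^-1)%:E *
     \int[lebesgue_measure]_(theta in `[0%R, (2 * pi)%R])
        logplus ((cmod (f (circle_point r theta)))%:E^-1))%E.

Definition defect_at_0 (R : realType) (f : R[i] -> R[i]) : \bar R :=
  (1 - limf_esup (fun r : R => counting_N f r / characteristic_T f r)
                 (pinfty_nbhs R))%E.

(* Main.v *)
Require Import Defs.
From mathcomp Require Import measurable_realfun ring lra zify.

Set Implicit Arguments.
Unset Strict Implicit.
Unset Printing Implicit Defensive.

Import Order.TTheory GRing.Theory Num.Theory.

Local Open Scope classical_set_scope.
Local Open Scope ring_scope.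
Local Open Scope complex_scope.

(** The genus hypothesis provides a representation
    f = z^n e^Q prod_k E(z/a_k, m) with a_k real and max(m, deg Q) >= 2, and
    the whole theorem follows from one property of f, [paired_decay]: there are
    theta, delta, c > 0 and B(r) -> +oo with N(r) <= B(r) for large r and
    |f(r e^(i(theta+phi)))| |f(r e^(i(theta-phi)))| <= exp(- c B(r)) for
    0 <= phi <= delta. Taking phi = 0 gives a ray along which f tends to 0,
    hence also m(r) -> 0. Integrating log^+ 1/|f| over the arc
    [theta - delta, theta + delta], folded at its centre, gives at least
    delta c B(r) >= delta c N(r), so N/T stays away from 1 ([defect_gt0]). The majorant B comes from the crude bound
    N(r) <= sum_(|a_k| <= r) r/|a_k| of [counting_N_ge0_le].

    The rays are paired because the zeros may have both signs. For even m the
    leading term - Re u^(m+1)/(m+1) of log|E(u, m)| at u = 0 is odd in u, and for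
    odd m so is the leading term Re u^m/m at infinity: a ray on which this term
    does not vanish is favourable for the zeros of one sign only. On two rays
    symmetric about a ray where it vanishes its values are opposite.

    If deg Q > m, the factor e^Q dominates ([paired_decay_exponential]): on a
    suitable arc Re Q <= - kappa r^(deg Q) up to lower-order terms, while [ln_primary_le] and the
    convergence of the series of |a_k|^-(m+1) make the logarithm of the product
    at most o(r^(m+1)).

    If deg Q <= m, so that m >= 2, let p be the odd one among m and m + 1, and
    take theta = 3 pi / (2 p) or its opposite. Integrating
    d/dt log|E(t e^(i theta), m)|, which is
    - t^m (cos((m+1) theta) - t cos(m theta)) / |1 - t e^(i theta)|^2,
    over a pair of rays shows that both signs of t contribute a negative
    quantity, at most - c |t|^(p+1) / (1 + t^2) ([ln_primary_pair_le]). Summed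
    over t = r/a_k this has larger order than r^(p-1), because m is minimal
    ([kernel_sum_large]); and the only term of Q that could compete, of degree
    p, is nonpositive on one of the two opposite choices of theta
    ([Re_horner_pair]). *)

(** * The logarithm of a primary factor along a ray *)

Definition sqdist1 (R : realType) (theta t : R) : R :=
  1 - 2 * t * cos theta + t ^+ 2.

(** This is log|E(t e^(i theta), m)|: the identity is [cmod_primary_factor]. *)
Definition ln_primary (R : realType) (m : nat) (theta t : R) : R :=
  ln (sqdist1 theta t) / 2
    + \sum_(1 <= j < m.+1) t ^+ j * cos (j%:R * theta) / j%:R.

Section Log_primary.
Variable R : realType.
Implicit Types (theta phi t r : R) (m p : nat).

Lemma scaleRE (x y : R) : x *: (y : R^o) = x * y.
Proof. by []. Qed.

Lemma sqdist1E theta t :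
  sqdist1 theta t = (t - cos theta) ^+ 2 + sin theta ^+ 2.
Proof. by rewrite sin2cos2 /sqdist1; ring. Qed.

Lemma sqdist1E2 theta t :
  sqdist1 theta t = (1 - t * cos theta) ^+ 2 + t ^+ 2 * sin theta ^+ 2.
Proof. by rewrite sin2cos2 /sqdist1; ring. Qed.

Lemma sqdist1_gt0 theta t : sin theta != 0 -> 0 < sqdist1 theta t.
Proof.
move=> s0; rewrite sqdist1E ltr_wpDl ?sqr_ge0//.
by rewrite exprn_even_gt0.
Qed.

Lemma sqdist1_le theta t : sqdist1 theta t <= 2 * (1 + t ^+ 2).
Proof.
rewrite /sqdist1.
have c2 : cos theta ^+ 2 <= 1 by rewrite cos2sin2 lerBlDr lerDl sqr_ge0.
have := sqr_ge0 (t + cos theta); nra.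
Qed.

Lemma ln_primary0 m theta : ln_primary m theta 0 = 0.
Proof.
rewrite /ln_primary /sqdist1 mulr0 mul0r expr0n subr0 addr0 ln1 mul0r add0r.
rewrite big_nat big1// => j /andP[j1 _].
by rewrite expr0n gtn_eqF ?mul0r.
Qed.

Lemma ln_primaryS m theta t : ln_primary m.+1 theta t =
  ln_primary m theta t + t ^+ m.+1 * cos (m.+1%:R * theta) / m.+1%:R.
Proof. by rewrite /ln_primary big_nat_recr//= addrA. Qed.

Lemma ln_primaryN m theta t : ln_primary m (- theta) t = ln_primary m theta t.
Proof.
rewrite /ln_primary /sqdist1 cosN; congr (_ + _).
by apply: eq_bigr => j _; rewrite mulrN cosN.
Qed.

Lemma cos_natDpi n x : cos (x + n%:R * pi) = (-1) ^+ n * cos x :> R.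
Proof.
elim: n x => [|n IH] x; first by rewrite mul0r addr0 expr0 mul1r.
rewrite -natr1 mulrDl mul1r addrA cosDpi IH exprS.
by rewrite mulN1r mulNr.
Qed.

Lemma ln_primary_opp m theta t : ln_primary m theta (- t) = ln_primary m (theta + pi) t.
Proof.
rewrite /ln_primary /sqdist1 cosDpi sqrrN mulrN mulNr mulrN; congr (_ + _).
apply: eq_bigr => j _; rewrite mulrDr cos_natDpi [(- t) ^+ j]exprNn.
by congr (_ / _); rewrite -mulrA mulrCA.
Qed.

Lemma cos_rec n theta : cos (n%:R * theta) + cos (n.+2%:R * theta) =
  2 * cos theta * cos (n.+1%:R * theta).
Proof.
have -> : n%:R * theta = n.+1%:R * theta - theta by rewrite -natr1; ring.
have -> : n.+2%:R * theta = n.+1%:R * theta + theta.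
  by rewrite -(natr1 n.+1); ring.
by rewrite cosB cosD; ring.
Qed.

(** The logarithmic derivative of E(u, m) is - u^m / (1 - u): the exponential
    factor cancels the first m terms of the geometric series. *)
Lemma is_derive_ln_primary m theta t : sin theta != 0 ->
  is_derive t 1 (ln_primary m theta)
   (- (t ^+ m * (cos (m.+1%:R * theta) - t * cos (m%:R * theta)))
      / sqdist1 theta t).
Proof.
move=> s0; have D0 := sqdist1_gt0 t s0.
elim: m => [|m IH].
  have -> : ln_primary 0 theta = (fun u => ln (sqdist1 theta u) / 2).
    by apply/funext => u; rewrite /ln_primary big_geq// addr0.
  have dD : is_derive t 1 (sqdist1 theta) (2 * t - 2 * cos theta).
    rewrite /sqdist1; apply: is_derive_eq; rewrite !scaleRE; ring.
  have dl : is_derive (sqdist1 theta t) 1 (@ln R) (sqdist1 theta t)^-1.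
    exact: is_derive1_ln.
  have dc : is_derive t 1 ((@ln R) \o sqdist1 theta)
     ((sqdist1 theta t)^-1 *: (2 * t - 2 * cos theta)).
    exact: is_derive1_comp.
  have {}dc : is_derive t 1 (fun u => ln (sqdist1 theta u))
    ((sqdist1 theta t)^-1 *: (2 * t - 2 * cos theta)) by exact: dc.
  apply: is_derive_eq.
  rewrite !scaleRE expr0 mul0r cos0 !mul1r mulr1.
  by field; rewrite gt_eqF.
have -> : ln_primary m.+1 theta = (fun u => ln_primary m theta u +
    u ^+ m.+1 * (cos (m.+1%:R * theta) / m.+1%:R)).
  by apply/funext => u; rewrite ln_primaryS mulrA.
have dX : is_derive t 1 (fun u : R => u ^+ m.+1) (m.+1%:R * t ^+ m).
  have -> : (fun u : R => u ^+ m.+1) = id ^+ m.+1 by rewrite exprfctE.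
  by apply: is_derive_eq; rewrite scaleRE mulr1 mulr_natl.
apply: is_derive_eq; rewrite !scaleRE.
have := cos_rec m theta; rewrite exprS.
set c0 := cos (m%:R * theta); set c1 := cos (m.+1%:R * theta).
set c2 := cos (m.+2%:R * theta) => /(canRL (addKr _)) ->.
have m0 : m.+1%:R != 0 :> R by rewrite pnatr_eq0.
move: D0; rewrite /sqdist1 => D0.
move: (t ^+ m) c0 c1 c2 (m.+1%:R : R) m0 => tm c0 c1 _ d d0.
by field; rewrite d0 gt_eqF.
Qed.

Lemma le_of_derive (f g f' g' : R -> R) (t : R) : 0 <= t -> f 0 = g 0 ->
  (forall x : R, 0 <= x -> is_derive x 1 f (f' x)) ->
  (forall x : R, 0 <= x -> is_derive x 1 g (g' x)) ->
  (forall x : R, 0 <= x -> f' x <= g' x) -> f t <= g t.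
Proof.
move=> t0 fg0 df dg fg.
suff : (g - f) 0 <= (g - f) t by rewrite !fctE fg0 subrr subr_ge0.
have dh (x : R) : 0 <= x -> is_derive x 1 (g - f) (g' x - f' x).
  by move=> x0; have := df x x0; have := dg x x0; move=> ? ?; exact: is_deriveB.
have [<-|tn0] := eqVneq 0 t; first exact: lexx.
have tgt0 : 0 < t by rewrite lt_neqAle tn0.
apply: (@ger0_derive1_le_cc _ _ 0 t) => //; rewrite ?bound_itvE//.
- by move=> x; rewrite in_itv/= => /andP[x0 _]; have [] := dh x (ltW x0).
- move=> x; rewrite in_itv/= => /andP[x0 _].
  rewrite derive1E (@derive_val _ _ _ _ _ _ _ (dh x (ltW x0))).
  by rewrite subr_ge0 fg// ltW.
- apply: derivable_within_continuous => x; rewrite in_itv/= => /andP[x0 _].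
  by have [] := dh x x0.
Qed.

End Log_primary.

(** A smooth stand-in for min(|x|^(p+1), |x|^(p-1)), easy to differentiate: the
    size of the contribution of a zero a to the decay at radius x |a|. *)
Definition decay_kernel (R : realType) (p : nat) (x : R) : R :=
  x ^+ p.+1 / (1 + x ^+ 2).

Section Log_primary_bounds.
Variable R : realType.
Implicit Types (theta phi t s : R) (m p : nat).

Lemma is_derive_exprn n t : is_derive t 1 (fun u : R => u ^+ n) (n%:R * t ^+ n.-1).
Proof.
case: n => [|n].
  by rewrite mul0r; exact: is_derive_cst.
have -> : (fun u : R => u ^+ n.+1) = id ^+ n.+1 by rewrite exprfctE.
by apply: is_derive_eq; rewrite scaleRE mulr1 mulr_natl.
Qed.

(** Away from the real axis |1 - x e^(i theta)|^2 is at least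
    s^2 (1 + x^2) / 2, so the derivative of the left side is at most
    4 x^m / (s^2 (1 + x)), which the derivative of the right side dominates. *)
Lemma ln_primary_le_nonneg m theta s t : 0 < s -> s <= `|sin theta| -> 0 <= t ->
  ln_primary m theta t <= 4 / s ^+ 2 * (t ^+ m * ln (1 + t)).
Proof.
move=> s0 ssin t0.
have sin0 : sin theta != 0 by rewrite -normr_gt0 (lt_le_trans s0).
have s2 : s ^+ 2 <= sin theta ^+ 2.
  by rewrite -[leRHS]real_normK ?num_real// lerXn2r ?nnegrE// ltW.
pose C := 4 / s ^+ 2.
have C0 : 0 < C by rewrite divr_gt0// exprn_gt0.
apply: (@le_of_derive _ _ (fun u => C * (u ^+ m * ln (1 + u)))
  (fun x => - (x ^+ m * (cos (m.+1%:R * theta) - x * cos (m%:R * theta)))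
      / sqdist1 theta x)
  (fun x => C * (x ^+ m / (1 + x) + ln (1 + x) * (m%:R * x ^+ m.-1)))
  t t0).
- by rewrite ln_primary0 addr0 ln1 !mulr0.
- by move=> x _; exact: is_derive_ln_primary.
- move=> x x0; have dX := is_derive_exprn m x.
  have d1 : is_derive (x : R) 1 (fun u : R => 1 + u) 1.
    by apply: is_derive_eq; rewrite add0r mulr1.
  have dl : is_derive (1 + x) 1 (@ln R) (1 + x)^-1.
    by apply: is_derive1_ln; rewrite ltr_pwDl.
  have dc : is_derive x 1 (fun u => ln (1 + u)) ((1 + x)^-1 *: 1).
    exact: (is_derive1_comp (f := @ln R) (g := fun u : R => 1 + u)).
  by apply: is_derive_eq; rewrite !scaleRE; ring.
- move=> x x0; have D0 := sqdist1_gt0 x sin0.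
  have x10 : 0 < 1 + x by rewrite ltr_pwDl.
  have xm0 : 0 <= x ^+ m by rewrite exprn_ge0.
  have ln0 : 0 <= ln (1 + x) by rewrite ln_ge0// lerDl.
  apply: (@le_trans _ _ (C * (x ^+ m / (1 + x)))); last first.
    rewrite ler_pM2l// lerDl mulr_ge0// mulr_ge0//.
    by rewrite exprn_ge0.
  apply: (@le_trans _ _ (x ^+ m * ((1 + x) / sqdist1 theta x))).
    rewrite -mulrN -!mulrA ler_wpM2l// ler_pM2r ?invr_gt0//.
    rewrite opprB lerBlDr.
    have := cos_geN1 (m.+1%:R * theta); have := cos_le1 (m%:R * theta).
    set c0 := cos (m%:R * _); set c1 := cos _ => h0 h1.
    have : x * c0 <= x by rewrite ler_piMr.
    lra.
  rewrite [leRHS]mulrCA ler_wpM2l// ler_pdivrMr//.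
  have Dge : s ^+ 2 * (1 + x ^+ 2) <= 2 * sqdist1 theta x.
    have h1 := sqdist1E theta x; have h2 := sqdist1E2 theta x.
    have := sqr_ge0 (x - cos theta); have := sqr_ge0 (1 - x * cos theta).
    have : x ^+ 2 * s ^+ 2 <= x ^+ 2 * sin theta ^+ 2 by rewrite ler_wpM2l// sqr_ge0.
    lra.
  have s20 : 0 < s ^+ 2 by rewrite exprn_gt0.
  rewrite [leRHS](_ : _ = 4 * sqdist1 theta x / (s ^+ 2 * (1 + x))); last first.
    by rewrite /C; field; rewrite !gt_eqF.
  rewrite ler_pdivlMr ?mulr_gt0//.
  have : 0 <= s ^+ 2 * (1 - x) ^+ 2 by rewrite mulr_ge0 ?sqr_ge0.
  lra.
Qed.

(** A bound of the form C |t|^(m+1) would not do: the logarithm is what makes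
    the sum over all zeros little-o of r^(m+1). *)
Lemma ln_primary_le m theta s t : 0 < s -> s <= `|sin theta| ->
  ln_primary m theta t <= 4 / s ^+ 2 * (`|t| ^+ m * ln (1 + `|t|)).
Proof.
move=> s0 ssin; have [t0|t0] := leP 0 t.
  by rewrite ger0_norm//; exact: ln_primary_le_nonneg.
rewrite ltr0_norm// -[t in ln_primary _ _ t]opprK ln_primary_opp.
by apply: ln_primary_le_nonneg => //; rewrite ?sinDpi ?normrN// oppr_ge0 ltW.
Qed.

Lemma decay_kernel_norm p t : odd p -> decay_kernel p `|t| = decay_kernel p t.
Proof.
move=> op; have ev : ~~ odd p.+1 by rewrite /= op.
rewrite /decay_kernel -[`|t| ^+ p.+1]normrX -[`|t| ^+ 2]normrX.
by rewrite !ger0_norm// ?sqr_ge0// exprn_even_ge0.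
Qed.

(** Since p theta is three quarters of a turn, the two derivatives add up to
    - t^p times a sum of three nonnegative terms: sin(theta + (p+1) phi) and
    sin(theta - (p+1) phi) over the squared distances, and a product of sines
    coming from the difference of these distances. The factor t^p is odd, hence
    the sum of logarithms decreases when t moves away from 0 in either
    direction, whatever the sign of the zero. *)
Lemma ln_primary_pair_le p theta phi s t :
    odd p -> cos (p%:R * theta) = 0 -> sin (p%:R * theta) = -1 ->
    0 <= sin theta -> 0 <= sin phi -> 0 <= sin (p%:R * phi) ->
    sin (theta + phi) != 0 -> sin (theta - phi) != 0 -> 0 < s ->
    s <= sin (theta + p.+1%:R * phi) -> s <= sin (theta - p.+1%:R * phi) ->
  ln_primary p (theta + phi) t + ln_primary p (theta - phi) t
    <= - (s / p.+1%:R) * decay_kernel p t.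
Proof.
move=> op cp sp st sphi spp n1 n2 s0 s1 s2.
rewrite -decay_kernel_norm//.
(* e is the sign of t: both directions are treated as x >= 0 with t = e x *)
have [e [e1 ep te]] : exists e : R, [/\ e ^+ 2 = 1, e * e ^+ p = 1 & t = e * `|t|].
  have [t0|t0] := leP 0 t.
    by exists 1; rewrite !expr1n !mul1r ger0_norm.
  exists (-1); rewrite sqrrN expr1n -signr_odd op expr1 mulN1r opprK.
  by rewrite mulN1r ltr0_norm// opprK.
rewrite {1 2}te; move: (normr_ge0 t); move: (`|t| : R) => x {t te} x0.
pose DP := sqdist1 (theta + phi); pose DM := sqdist1 (theta - phi).
have cP : cos (p.+1%:R * (theta + phi)) = sin (theta + p.+1%:R * phi).
  have -> : p.+1%:R * (theta + phi) = p%:R * theta + (theta + p.+1%:R * phi).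
    by rewrite -natr1; ring.
  by rewrite cosD cp sp; ring.
have cM : cos (p.+1%:R * (theta - phi)) = sin (theta - p.+1%:R * phi).
  have -> : p.+1%:R * (theta - phi) = p%:R * theta + (theta - p.+1%:R * phi).
    by rewrite -natr1; ring.
  by rewrite cosD cp sp; ring.
have cP0 : cos (p%:R * (theta + phi)) = sin (p%:R * phi).
  by rewrite mulrDr cosD cp sp; ring.
have cM0 : cos (p%:R * (theta - phi)) = - sin (p%:R * phi).
  by rewrite mulrBr cosB cp sp; ring.
pose f' u : R := - (u ^+ p *
  ((sin (theta + p.+1%:R * phi) - e * u * sin (p%:R * phi)) / DP (e * u)
  + (sin (theta - p.+1%:R * phi) + e * u * sin (p%:R * phi)) / DM (e * u))).
pose k := s / p.+1%:R.
have k0 : 0 < k by rewrite divr_gt0.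
pose g' (u : R) : R := - k * ((p.+1%:R * u ^+ p * (1 + u ^+ 2)
   - u ^+ p.+1 * (2 * u)) / (1 + u ^+ 2) ^+ 2).
have x21 (u : R) : 0 < 1 + u ^+ 2 by rewrite ltr_pwDl// sqr_ge0.
apply: (@le_of_derive _ (fun u => ln_primary p (theta + phi) (e * u) +
   ln_primary p (theta - phi) (e * u)) (fun u => - k * decay_kernel p u) f' g' x x0).
- by rewrite mulr0 !ln_primary0 /decay_kernel expr0n/= mul0r mulr0 addr0.
- move=> u _.
  have de : is_derive (u : R) 1 (fun u : R => e * u) e.
    by apply: is_derive_eq; rewrite scaleRE mulr1.
  have dP := is_derive_ln_primary p (e * u) n1; have dM := is_derive_ln_primary p (e * u) n2.
  have dP' := is_derive1_comp (f := ln_primary p (theta + phi)) (g := fun u : R => e * u) dP de.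
  have dM' := is_derive1_comp (f := ln_primary p (theta - phi)) (g := fun u : R => e * u) dM de.
  apply: (@is_derive_eq _ _ _ _ _ _ _ _ (is_deriveD dP' dM')).
  rewrite cP cM cP0 cM0 /f' exprMn -/DP -/DM.
  transitivity (- (e * e ^+ p * u ^+ p *
  ((sin (theta + p.+1%:R * phi) - e * u * sin (p%:R * phi)) / DP (e * u)
  + (sin (theta - p.+1%:R * phi) + e * u * sin (p%:R * phi)) / DM (e * u)))).
    by ring.
  by rewrite ep mul1r.
- move=> u u0; have dX := is_derive_exprn p.+1 u; have dX2 := is_derive_exprn 2 u.
  have dV : is_derive u 1 (fun u : R => (1 + u ^+ 2)^-1)
     (- (1 + u ^+ 2) ^- 2 *: (2 * u)).
    apply: is_derive_eq.
      apply: is_deriveV; last by rewrite gt_eqF.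
    by rewrite ?scaleRE /=; ring.
  rewrite /decay_kernel; apply: is_derive_eq; rewrite !scaleRE /g' /=.
  by field; rewrite gt_eqF.
- move=> u u0; rewrite /f' /g' mulNr lerN2.
  have P0 : 0 < DP (e * u) by exact: sqdist1_gt0.
  have M0 : 0 < DM (e * u) by exact: sqdist1_gt0.
  have eu : (e * u) ^+ 2 = u ^+ 2 by rewrite exprMn e1 mul1r.
  have P2 : DP (e * u) <= 2 * (1 + u ^+ 2) by rewrite -eu sqdist1_le.
  have M2 : DM (e * u) <= 2 * (1 + u ^+ 2) by rewrite -eu sqdist1_le.
  have up : 0 <= u ^+ p by rewrite exprn_ge0.
  apply: (@le_trans _ _ (u ^+ p * (s / (1 + u ^+ 2)))).
    rewrite -[k]/(s / p.+1%:R) [u ^+ p.+1]exprS.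
    rewrite [leRHS](_ : _ = (s / p.+1%:R) * u ^+ p * (p.+1%:R / (1 + u ^+ 2))); last first.
      by field; rewrite gt_eqF//= ?nat1r ?natr1 pnatr_eq0.
    rewrite [leLHS](_ : _ = (s / p.+1%:R) * u ^+ p *
       ((p.+1%:R * (1 + u ^+ 2) - 2 * u ^+ 2) / (1 + u ^+ 2) ^+ 2)); last first.
      by field; rewrite gt_eqF//= ?nat1r ?natr1 pnatr_eq0.
    rewrite ler_wpM2l ?(mulr_ge0 (ltW k0))// ler_pdivrMr ?exprn_gt0//.
    rewrite [leRHS](_ : _ = p.+1%:R * (1 + u ^+ 2)); last by field; rewrite gt_eqF.
    rewrite lerBlDr lerDl.
    by rewrite mulr_ge0// sqr_ge0.
  rewrite ler_wpM2l//.
  have PM : DP (e * u) - DM (e * u) = 4 * (e * u) * (sin theta * sin phi).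
    by rewrite /DP /DM /sqdist1 cosB cosD; ring.
  set SP := sin (theta + _) in s1 *; set SM := sin (theta - _) in s2 *.
  rewrite [leRHS](_ : _ = SP / DP (e * u) + SM / DM (e * u)
    + 4 * (e * u) ^+ 2 * (sin theta * sin phi * sin (p%:R * phi))
     / (DP (e * u) * DM (e * u))); last first.
    transitivity (SP / DP (e * u) + SM / DM (e * u)
       + (e * u) * sin (p%:R * phi) * (DP (e * u) - DM (e * u))
     / (DP (e * u) * DM (e * u))).
      by field; rewrite !gt_eqF.
    by rewrite PM; congr (_ + _); ring.
  have hP : s / (2 * (1 + u ^+ 2)) <= SP / DP (e * u).
    by rewrite ler_pM ?invr_ge0 ?(ltW s0)// ?mulr_ge0// ?(ltW (x21 _))// lef_pV2// posrE mulr_gt0.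
  have hM : s / (2 * (1 + u ^+ 2)) <= SM / DM (e * u).
    by rewrite ler_pM ?invr_ge0 ?(ltW s0)// ?mulr_ge0// ?(ltW (x21 _))// lef_pV2// posrE mulr_gt0.
  have hr : 0 <= 4 * (e * u) ^+ 2 * (sin theta * sin phi * sin (p%:R * phi))
     / (DP (e * u) * DM (e * u)).
    have PM0 : 0 <= DP (e * u) * DM (e * u) by rewrite mulr_ge0// ltW.
    apply: divr_ge0 => //; apply: mulr_ge0; last by rewrite !mulr_ge0.
    by apply: mulr_ge0 => //; exact: sqr_ge0.
  have hs : s / (1 + u ^+ 2) = s / (2 * (1 + u ^+ 2)) + s / (2 * (1 + u ^+ 2)).
    by field; rewrite gt_eqF.
  rewrite hs; lra.
Qed.

End Log_primary_bounds.

(** * Moduli on a circle *)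

Section Complex_modulus.
Variable R : realType.
Implicit Types (x y z : R[i]) (r t theta : R) (m n : nat).

Lemma ReD x y : complex.Re (x + y) = complex.Re x + complex.Re y.
Proof. by case: x => a b; case: y. Qed.

Lemma Re_sum (I : Type) (s : seq I) (P : pred I) (F : I -> R[i]) :
  complex.Re (\sum_(i <- s | P i) F i) = \sum_(i <- s | P i) complex.Re (F i).
Proof.
by elim/big_rec2: _ => //= i a b _ <-; rewrite ReD.
Qed.

Lemma cmodE z : cmod z = Num.sqrt (complex.Re z ^+ 2 + complex.Im z ^+ 2).
Proof. by case: z. Qed.

Lemma cmod_ge0 z : 0 <= cmod z.
Proof. by rewrite cmodE sqrtr_ge0. Qed.

Lemma cmodM x y : cmod (x * y) = cmod x * cmod y.
Proof. exact: Normc.normcM. Qed.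

Lemma cmod0 : cmod (0 : R[i]) = 0.
Proof. exact: Normc.normc0. Qed.

Lemma cmod1 : cmod (1 : R[i]) = 1.
Proof. exact: Normc.normc1. Qed.

Lemma cmod_eq0 z : cmod z = 0 -> z = 0.
Proof. exact: Normc.eq0_normc. Qed.

Lemma cmod_real r : cmod r%:C = `|r|.
Proof. by rewrite cmodE /= expr0n addr0 sqrtr_sqr. Qed.

Lemma cmodX z n : cmod (z ^+ n) = cmod z ^+ n.
Proof.
by elim: n => [|n IH]; rewrite ?expr0 ?cmod1// !exprS cmodM IH.
Qed.

Lemma cmod_prod (I : Type) (s : seq I) (P : pred I) (F : I -> R[i]) :
  cmod (\prod_(i <- s | P i) F i) = \prod_(i <- s | P i) cmod (F i).
Proof.
by elim/big_rec2: _ => [|i a b _ <-]; rewrite ?cmod1 ?cmodM.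
Qed.

Lemma normC_cmod z : `|z| = (cmod z)%:C.
Proof. by rewrite normc_def cmodE. Qed.

Lemma cmod_cexp z : cmod (cexp z) = expR (complex.Re z).
Proof.
rewrite /cexp cmodM cmod_real ger0_norm ?expR_ge0// cmodE /= cos2Dsin2.
by rewrite sqrtr1 mulr1.
Qed.

Lemma circle_pointE r theta : circle_point r theta = (r * cos theta) +i* (r * sin theta).
Proof.
rewrite /circle_point /cexp /= expR0 mul1r.
by apply/eqP; rewrite eq_complex /= !mul0r subr0 addr0 !eqxx.
Qed.

Lemma cmod_circle_point r theta : cmod (circle_point r theta) = `|r|.
Proof. by rewrite /circle_point cmodM cmod_real cmod_cexp /= expR0 mulr1. Qed.

Lemma circle_pointM r s theta phi :
  circle_point r theta * circle_point s phi = circle_point (r * s) (theta + phi).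
Proof.
rewrite !circle_pointE; apply/eqP; rewrite eq_complex /= cosD sinD.
by apply/andP; split; apply/eqP; ring.
Qed.

Lemma circle_pointX r theta n :
  circle_point r theta ^+ n = circle_point (r ^+ n) (n%:R * theta).
Proof.
elim: n => [|n IH].
  by rewrite !expr0 mul0r circle_pointE cos0 sin0 mulr0 mulr1.
by rewrite !exprS IH circle_pointM -natr1 mulrDl mul1r addrC.
Qed.

Lemma circle_point_div r theta t :
  circle_point r theta / t%:C = circle_point (r / t) theta.
Proof.
have -> : (t%:C)^-1 = circle_point t^-1 0.
  by rewrite circle_pointE cos0 sin0 mulr1 mulr0 -[LHS]fmorphV.
by rewrite circle_pointM addr0.
Qed.

Lemma circle_point_2pi r theta : circle_point r (theta + 2 * pi) = circle_point r theta.
Proof. by rewrite !circle_pointE mulr_natl cosD2pi sinD2pi. Qed.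

Lemma Re_coef_circle (c : R[i]) r theta : complex.Re (c * circle_point r theta)
  = r * (complex.Re c * cos theta - complex.Im c * sin theta).
Proof. by rewrite circle_pointE; case: c => a b /=; ring. Qed.

Lemma Re_coef_circle_le (c : R[i]) r theta :
  `|complex.Re (c * circle_point r theta)| <= cmod c * `|r|.
Proof.
rewrite -(cmod_circle_point r theta) -cmodM [leRHS]cmodE.
by rewrite -[leLHS]sqrtr_sqr ler_sqrt ?lerDl ?addr_ge0 ?sqr_ge0.
Qed.

Lemma cmod_primary_factor m r theta t : sin theta != 0 ->
  cmod (primary_factor m (circle_point r theta / t%:C))
    = expR (ln_primary m theta (r / t)).
Proof.
move=> s0; rewrite circle_point_div; move: (r / t) => {r}x.
rewrite /primary_factor cmodM cmod_cexp /ln_primary expRD; congr (_ * expR _).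
  have D0 := sqdist1_gt0 x s0.
  rewrite -[RHS]ger0_norm ?expR_ge0// -sqrtr_sqr.
  rewrite -expRM_natl [2%:R * _](_ : _ = ln (sqdist1 theta x)); last by field.
  rewrite lnK ?posrE// circle_pointE cmodE /= sqdist1E2.
  by congr Num.sqrt; ring.
rewrite Re_sum; apply: eq_bigr => j _.
rewrite circle_pointX circle_pointE.
have -> : (j%:R : R[i])^-1 = (j%:R^-1)%:C by rewrite fmorphV rmorph_nat.
by rewrite /= mulr0 subr0.
Qed.

End Complex_modulus.

Section Complex_limits.
Variable R : realType.

Lemma cvg_cmodP (T : Type) (F : set_system T) {FF : Filter F} (u : T -> R[i]) (l : R[i]) :
  (u @ F --> (l : R[i]^o)) <->
  (forall e : R, 0 < e -> \forall x \near F, cmod (l - u x) < e).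
Proof.
split=> [/(@cvgrPdist_lt _ (R[i]^o) _ F FF) h e e0|h].
  have /h : 0 < e%:C by rewrite ltcR.
  by apply: filterS => x; rewrite normC_cmod ltcR.
apply/(@cvgrPdist_lt _ (R[i]^o) _ F FF) => e; rewrite ltcE /= => /andP[/eqP ie re].
have {ie}-> : e = (complex.Re e)%:C by case: e ie re => a b /= ->.
have := h _ re.
by apply: filterS => x; rewrite normC_cmod ltcR.
Qed.

Lemma cmod_triangle (x y : R[i]) : cmod (x + y) <= cmod x + cmod y.
Proof. exact: le_normcD. Qed.

Lemma cmodN (x : R[i]) : cmod (- x) = cmod x.
Proof. by case: x => a b; rewrite !cmodE /= !sqrrN. Qed.

Lemma cvg_cmod (T : Type) (F : set_system T) {FF : Filter F}
   (u : T -> R[i]) (l : R[i]) :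
  u @ F --> (l : R[i]^o) -> cmod (u x) @[x --> F] --> cmod l.
Proof.
move=> /cvg_cmodP ul; apply/(@cvgrPdist_lt _ R^o _ F FF) => e /ul.
apply: filterS => t; apply: le_lt_trans; move: (u t) => {t} y.
have := cmod_triangle (l - y) y; have := cmod_triangle (y - l) l.
rewrite !subrK -[y - l]opprB cmodN => t1 t2.
by rewrite ler_norml; apply/andP; split; lra.
Qed.

End Complex_limits.

(** * The counting function of the zeros *)

Section Counting.
Variable R : realType.

Lemma esum_card (T : choiceType) (J : set T) (n : nat) : (J #= `I_n)%card ->
  (\esum_(k in J) (1 : \bar R) = n%:R%:E)%E.
Proof.
move=> /card_set_bijP[e be].
rewrite -(reindex_esum J `I_n e (fun=> 1%E) be) -[`I_n]set_mem_set esum_fset//; last first.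
  by rewrite set_mem_set.
by rewrite set_mem_set -fsbig_ord sumEFin sumr_const card_ord.
Qed.

Lemma esum_nat_le (S : set nat) (g : nat -> R) (b : R) :
  (forall k, S k -> 0 <= g k) ->
  (forall N, \sum_(0 <= k < N | k \in S) g k <= b) ->
  (\esum_(k in S) (g k)%:E <= b%:E)%E.
Proof.
move=> g0 gb.
have -> : S = [set k | k \in S] by rewrite set_mem_set.
rewrite -nneseries_esum; last by move=> k; rewrite inE lee_fin => /g0.
apply: lime_le.
  by apply: is_cvg_nneseries_cond => k _; rewrite inE lee_fin => /g0.
apply: nearW => N; rewrite sumEFin lee_fin.
exact: gb.
Qed.

(** The integral of a nonnegative function is a supremum over the simple
    functions below it, so monotonicity holds for arbitrary functions. *)
Lemma ge0_le_integral_sup d (T : measurableType d) (mu : {measure set T -> \bar R})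
   (D : set T) (f g : T -> \bar R) :
  (forall x, D x -> (0 <= f x)%E) -> (forall x, D x -> (f x <= g x)%E) ->
  (\int[mu]_(x in D) f x <= \int[mu]_(x in D) g x)%E.
Proof.
move=> f0 fg.
have g0 x : D x -> (0 <= g x)%E by move=> Dx; rewrite (le_trans (f0 x Dx))// fg.
rewrite !ge0_integralE//; apply: le_ereal_sup => _ [h /= hf <-].
exists h => //= x; apply: (le_trans (hf x)).
by rewrite /patch; case: ifPn => // /set_mem; exact: fg.
Qed.

Variable f : R[i] -> R[i].

Lemma zero_count0_fin_num : zero_count f 0 \is a fin_num.
Proof.
have [f0|f0] := pselect (f 0 = 0).
  rewrite /zero_count (_ : [set z | _] = [set 0]).
    by rewrite esum_set1// lee_fin.
  apply/seteqP; split=> [z [_ z0]|_ ->]; last by split; [exact: f0|rewrite cmod0].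
  by apply: cmod_eq0; apply/eqP; rewrite eq_le z0 cmod_ge0.
rewrite /zero_count (_ : [set z | _] = set0) ?esum_set0//.
apply/seteqP; split=> // z [/= fz z0]; apply: f0.
have zz : z = 0 by apply: cmod_eq0; apply/eqP; rewrite eq_le z0 cmod_ge0.
by rewrite -{1}zz.
Qed.

(** The zero at the origin contributes the same finite amount to n(t) and n(0),
    so the difference of extended reals is the sum over the other zeros. *)
Lemma zero_countB (t : R) : 0 <= t -> (zero_count f t - zero_count f 0%R =
  \esum_(z in [set z | [/\ f z = 0%R, z <> 0%R & (cmod z <= t)%R]])
     (multiplicity f z)%:R%:E)%E.
Proof.
move=> t0; rewrite {1}/zero_count (esumID [set z | z <> 0]); last first.
  by move=> z _; rewrite lee_fin.
rewrite [X in (_ + X - _)%E](_ : _ = zero_count f 0); last first.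
  rewrite /zero_count; congr esum; apply/seteqP; split=> z /=.
    by move=> [[fz _] /contrapT zz]; rewrite zz cmod0 -{1}zz.
  move=> [fz z0]; have zz : z = 0.
    by apply: cmod_eq0; apply/eqP; rewrite eq_le z0 cmod_ge0.
  by rewrite -{2}zz fz zz cmod0; split.
rewrite addeK ?zero_count0_fin_num//.
congr esum; apply/seteqP; split=> z /=; first by move=> [[]].
by case.
Qed.

Variables (K : set nat) (a : nat -> R[i]).
Hypothesis enum : enumerates_nonzero_zeros f K a.

(** Grouping the indices k by the value of a_k turns the sum of multiplicities
    into a number of indices. *)
Lemma zero_countB_le (t b : R) : 0 <= t ->
  (forall N, (\sum_(0 <= k < N | (k \in K) && (cmod (a k) <= t)) 1 <= b :> R)) ->
  (zero_count f t - zero_count f 0%R <= b%:E)%E.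
Proof.
move=> t0 hb; rewrite zero_countB//.
set Z := [set z | _].
pose J z := [set k | K k /\ a k = z].
rewrite (eq_esum (b := fun z => \esum_(k in J z) (1 : \bar R)%E)); last first.
  by move=> z [fz z0 zt]; rewrite (esum_card (enum.2 z z0)).
rewrite esum_esum; last by move=> *; rewrite lee_fin.
pose S := [set k | K k /\ Z (a k)].
rewrite (reindex_esum S _ (fun k => (a k, k))); last first.
  split=> [k [Kk Zk]|k l _ _ [_ ->]//|[z k] [/= Zz [Kk akz]]].
  - by split.
  - by exists k; rewrite -?akz//=; split => //; rewrite akz.
apply: (@esum_nat_le S (fun=> 1)) => // N.
apply: le_trans (hb N); rewrite big_mkcond [leRHS]big_mkcond.
apply: ler_sum => k _; case: ifPn => [|_]; last by case: ifP.
by rewrite inE => -[Kk [_ _ akt]]; rewrite (mem_set Kk) akt.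
Qed.

(** The integrand (n(t) - n(0))/t is at most the constant
    sum_(|a_k| <= r) 1/|a_k|, since 1/t <= 1/|a_k| when |a_k| <= t. This loses
    log x <= x for each zero, but spares the computation of N(r). *)
Lemma counting_N_ge0_le (r b : R) : 0 < r ->
  (forall N, \sum_(0 <= k < N | (k \in K) && (cmod (a k) <= r)) (r / cmod (a k))
     <= b) ->
  (0 <= counting_N f r <= b%:E)%E.
Proof.
move=> r0 hb.
have b0 : 0 <= b by have := hb 0%N; rewrite big_geq.
have n0 (t : R) : 0 <= t -> (0 <= zero_count f t - zero_count f 0%R)%E.
  by move=> t0; rewrite zero_countB// esum_ge0// => z _; rewrite lee_fin.
have q0 t : `[0, r]%classic t ->
    (0 <= (zero_count f t - zero_count f 0%R) / t%:E)%E.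
  rewrite /= in_itv/= => /andP[t0 _].
  by rewrite mule_ge0 ?n0// inve_ge0 lee_fin.
apply/andP; split; first exact: integral_ge0.
apply: (@le_trans _ _ (\int[lebesgue_measure]_(t in `[0%R, r]) (cst (b / r)%:E t))%E).
  apply: ge0_le_integral_sup => // t; rewrite /= in_itv/= => /andP[t0 tr].
  have := @zero_countB_le t (t * (b / r)) t0.
  have [->|tn0] := eqVneq t 0.
    move=> _; rewrite subee ?zero_count0_fin_num// mul0e /= lee_fin.
    by rewrite divr_ge0// ltW.
  have tgt0 : 0 < t by rewrite lt_neqAle eq_sym tn0.
  move=> h; rewrite inver (negbTE tn0) lee_pdivrMr//.
  rewrite -EFinM mulrC; apply: h => N.
  apply: (@le_trans _ _ (\sum_(0 <= k < N | (k \in K) && (cmod (a k) <= r))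
     (t / r * (r / cmod (a k))))).
    rewrite big_mkcond [leRHS]big_mkcond; apply: ler_sum => k _.
    have ak0 := cmod_ge0 (a k).
    case: ifPn => [/andP[Kk akt]|_].
      rewrite Kk (le_trans akt tr)/= mulrA divfK ?gt_eqF//.
      rewrite ler_pdivlMr ?mul1r// lt_neqAle ak0 andbT.
      apply/eqP => /esym/cmod_eq0; exact: (enum.1 k (set_mem Kk)).
    by case: ifP => // _; rewrite mulr_ge0// divr_ge0// ltW.
  rewrite -mulr_sumr mulrA [t * b / r]mulrAC ler_wpM2l// divr_ge0//; exact: ltW.
rewrite integral_cst//= lebesgue_measure_itv/= lte_fin r0 oppr0 addr0.
by rewrite -EFinM divfK// gt_eqF.
Qed.

End Counting.

(** * From decay on pairs of rays to a positive defect *)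

Section Reflection.
Variable R : realType.

Lemma measurable_reflect (c : R) : measurable_fun setT (fun x : R => c - x).
Proof. by apply: measurable_funB. Qed.

Lemma lebesgue_measure_reflect (c : R) (A : set R) : measurable A ->
  pushforward lebesgue_measure (fun x => c - x : measurableTypeR R) A
    = lebesgue_measure A.
Proof.
move=> mA; apply/esym/lebesgue_measure_unique => //=.
  exact: measurable_reflect.
move=> _ _ [[a b]] _ <-.
rewrite /pushforward /=.
rewrite [X in _ = lebesgue_measure X](_ : _ = `[c - b, c - a[%classic); last first.
  by apply/seteqP; split=> x /=; rewrite !in_itv/= => /andP[? ?]; apply/andP; split; lra.
rewrite !lebesgue_measure_itv/= !lte_fin.
rewrite (_ : (c - b < c - a) = (a < b)); last by apply/idP/idP => ?; lra.
by case: ifP => // _; rewrite -!EFinB; congr EFin; ring.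
Qed.

(** The integral of h over the arc equals that of h(2 theta - x); the sum of
    the two is the integral of h(x) + h(2 theta - x), which is at
    least A on an arc of length 2 delta. *)
Lemma integral_arc_ge (h : R -> \bar R) (theta delta A : R) :
  measurable_fun setT h -> (forall x, (0 <= h x)%E) -> 0 <= A -> 0 < delta ->
  0 <= theta - delta -> theta + delta <= 2 * pi ->
  (forall phi, 0 <= phi <= delta -> (A%:E <= h (theta + phi)%R + h (theta - phi)%R)%E) ->
  ((delta * A)%:E <= \int[lebesgue_measure]_(x in `[0%R, (2 * pi)%R]) h x)%E.
Proof.
move=> mh h0 A0 d0 td1 td2 hA.
pose D : set R := `[theta - delta, theta + delta]%classic.
have mD : measurable D by exact: measurable_itv.
pose h' x := h (2 * theta - x).
have mh' : measurable_fun setT h'.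
  exact: (measurableT_comp mh (measurable_reflect _)).
apply: (@le_trans _ _ (\int[lebesgue_measure]_(x in D) h x)%E); last first.
  apply: ge0_subset_integral => //=; first exact: measurable_funTS.
  by move=> x; rewrite /D /= !in_itv/= => /andP[? ?]; apply/andP; split; lra.
have DD : (fun x : R => 2 * theta - x) @^-1` D = D.
  by apply/seteqP; split=> x; rewrite /D /= !in_itv/= => /andP[? ?]; apply/andP; split; lra.
have eqI : (\int[lebesgue_measure]_(x in D) h x =
            \int[lebesgue_measure]_(x in D) h' x)%E.
  pose phi : R -> measurableTypeR R := fun x => 2 * theta - x.
  rewrite -[in RHS]DD.
  have -> : (\int[lebesgue_measure]_(x in phi @^-1` D) h' x =
     \int[pushforward lebesgue_measure phi]_(x in D) h x)%E.
    apply/esym/ge0_integral_pushforward => //.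
    - exact: measurable_reflect.
    - exact: measurable_funTS.
  apply: eq_measure_integral => //=; first exact: measurable_reflect.
  by move=> _ B mB _; exact/esym/lebesgue_measure_reflect.
have sumI : ((2 * delta * A)%:E <= \int[lebesgue_measure]_(x in D) h x +
    \int[lebesgue_measure]_(x in D) h' x)%E.
  rewrite -ge0_integralD//; try exact: measurable_funTS; last first.
    by move=> x _; exact: h0.
  apply: (@le_trans _ _ (\int[lebesgue_measure]_(x in D) (cst A%:E x))%E).
    rewrite integral_cst//= lebesgue_measure_itv/= lte_fin.
    rewrite (_ : theta - delta < theta + delta); last lra.
    by rewrite -EFinD -EFinM lee_fin le_eqVlt; apply/orP; left; apply/eqP; ring.
  apply: ge0_le_integral_sup => // x; rewrite /D /= in_itv/= => /andP[x1 x2].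
  have [xt|xt] := leP theta x.
    have := hA (x - theta); rewrite /h'.
    have -> : theta + (x - theta) = x by ring.
    have -> : theta - (x - theta) = 2 * theta - x by ring.
    by apply; apply/andP; split; lra.
  have := hA (theta - x); rewrite /h' addeC.
  have -> : theta - (theta - x) = x by ring.
  have -> : theta + (theta - x) = 2 * theta - x by ring.
  by apply; apply/andP; split; lra.
move: sumI; rewrite -eqI.
move: (integral _ _ _) => [v| |]//=; last by move=> _; rewrite leey.
by rewrite -EFinD !lee_fin => ?; lra.
Qed.

End Reflection.

Section Deficiency.
Variable R : realType.
Variable f : R[i] -> R[i].

Lemma logplusV_ge0 (x : R) : (0 <= logplus (x%:E^-1))%E.
Proof. by rewrite /logplus le_max lexx orbT. Qed.

Lemma logplusVE (x : R) : 0 <= x ->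
  logplus (x%:E^-1) = if x == 0 then +oo%E else (Num.max (- ln x) 0)%:E.
Proof.
move=> x0; rewrite /logplus inver; case: ifPn => [_|xn0].
  by rewrite /= maxye.
have xp : 0 < x by rewrite lt_neqAle eq_sym xn0.
by rewrite lne_EFin ?invr_gt0// lnV ?posrE// EFin_max.
Qed.

Lemma logplusV_add_ge (x y A : R) : 0 <= x -> 0 <= y -> x * y <= expR (- A) ->
  (A%:E <= logplus (x%:E^-1) + logplus (y%:E^-1))%E.
Proof.
move=> x0 y0 xy; rewrite !logplusVE//.
case: ifPn => [_|xn0]; first by case: ifP => _; rewrite leey.
case: ifPn => [_|yn0]; first by rewrite leey.
have xp : 0 < x by rewrite lt_neqAle eq_sym xn0.
have yp : 0 < y by rewrite lt_neqAle eq_sym yn0.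
rewrite -EFinD lee_fin.
have h1 : - ln x <= Num.max (- ln x) 0 by rewrite le_max lexx.
have h2 : - ln y <= Num.max (- ln y) 0 by rewrite le_max lexx.
have : ln (x * y) <= ln (expR (- A)) by rewrite ler_ln ?posrE ?mulr_gt0 ?expR_gt0.
rewrite expRK lnM ?posrE// => ?; lra.
Qed.

Hypothesis entf : entire f.

Lemma continuous_cmod_circle r : continuous (fun theta : R => cmod (f (circle_point r theta))).
Proof.
move=> theta.
have c1 : circle_point r phi @[phi --> theta] --> (circle_point r theta : R[i]^o).
  apply/cvg_cmodP => e e0.
  have cc : (fun phi : R => `|r| * (`|cos theta - cos phi| + `|sin theta - sin phi|)) phi
      @[phi --> theta] --> `|r| * (`|cos theta - cos theta| + `|sin theta - sin theta|).
    apply: cvgM; first exact: cvg_cst.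
    apply: cvgD; apply: cvg_norm; apply: cvgB; try exact: cvg_cst.
      exact: continuous_cos.
    exact: continuous_sin.
  move: cc; rewrite !subrr normr0 addr0 mulr0.
  move=> /cvgrPdist_lt/(_ e e0); apply: filterS => phi.
  rewrite sub0r normrN => h; apply: le_lt_trans h.
  rewrite (le_trans _ (ler_norm _))// !circle_pointE cmodE /=.
  rewrite -!mulrBr !exprMn -mulrDr sqrtrM ?sqr_ge0// sqrtr_sqr ler_wpM2l//.
  rewrite -[leRHS]ger0_norm ?addr_ge0// -sqrtr_sqr ler_sqrt ?sqr_ge0//.
  move: (cos _ - _) (sin _ - _) => x y.
  rewrite sqrrD -[x ^+ 2]real_normK ?num_real// -[y ^+ 2]real_normK ?num_real//.
  by rewrite addrAC lerDl mulrn_wge0// mulr_ge0.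
have c2 : (f : R[i]^o -> R[i]^o) z @[z --> (circle_point r theta : R[i]^o)]
    --> (f (circle_point r theta) : R[i]^o).
  apply: differentiable_continuous; apply/derivable1_diffP; exact: entf.
have c3 := cvg_comp _ _ c1 c2.
exact: (cvg_cmod c3).
Qed.

Lemma measurable_logplus_circle r :
  measurable_fun setT (fun theta : R => logplus ((cmod (f (circle_point r theta)))%:E^-1)).
Proof.
pose g theta := cmod (f (circle_point r theta)).
have mg : measurable_fun setT g.
  by apply: continuous_measurable_fun; exact: continuous_cmod_circle.
rewrite (_ : (fun _ => _) = fun theta => if g theta == 0 then +oo%E
   else (Num.max (- ln (g theta)) 0)%:E); last first.
  by apply/funext => theta; rewrite logplusVE// cmod_ge0.
apply: measurable_fun_ifT => //.
  by apply: measurable_fun_eqr.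
apply/measurable_EFinP; apply: measurable_maxr => //.
apply: measurableT_comp => //.
exact: measurableT_comp.
Qed.

(** The proximity term of T is at least c' B >= c' N, with
    c' = delta c / (2 pi), so that N/T <= 1/(1 + c'). *)
Lemma defect_gt0 (theta delta c : R) (B : R -> R) :
  0 < delta -> 0 <= theta - delta -> theta + delta <= 2 * pi -> 0 < c ->
  (\forall r \near +oo, 0 < B r /\ (0 <= counting_N f r <= (B r)%:E)%E) ->
  (\forall r \near +oo, forall phi, 0 <= phi <= delta ->
     cmod (f (circle_point r (theta + phi))) * cmod (f (circle_point r (theta - phi)))
       <= expR (- (c * B r))) ->
  (0 < defect_at_0 f)%E.
Proof.
move=> d0 td1 td2 c0 hN hM.
pose c' := (2 * pi)^-1 * (delta * c).
have pi0 : 0 < (2 * pi : R) by rewrite mulr_gt0// pi_gt0.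
have c'0 : 0 < c' by rewrite !mulr_gt0 ?invr_gt0.
rewrite /defect_at_0 sube_gt0.
apply: (@le_lt_trans _ _ ((1 + c')^-1)%:E); last first.
  by rewrite lte_fin invf_lt1 ?ltrDl// addr_gt0.
have hV := @filterI _ _ _ _ _ hN hM.
rewrite limf_esupE.
apply: (@le_trans _ _ (ereal_sup ((fun r => counting_N f r / characteristic_T f r)%E @`
   [set r | (0 < B r /\ (0 <= counting_N f r <= (B r)%:E)%E) /\
     (forall phi, 0 <= phi <= delta ->
     cmod (f (circle_point r (theta + phi))) * cmod (f (circle_point r (theta - phi)))
       <= expR (- (c * B r)))]))).
  by apply: ereal_inf_lbound; eexists; first exact: hV.
apply: ge_ereal_sup => _ [r [[B0 NB] fB] <-].
have cB : 0 <= c * B r by rewrite mulr_ge0 ?ltW.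
have := integral_arc_ge (measurable_logplus_circle r) (fun x => logplusV_ge0 _)
   cB d0 td1 td2 (fun phi hphi => logplusV_add_ge (cmod_ge0 _) (cmod_ge0 _) (fB phi hphi)).
rewrite /characteristic_T.
set I := (\int[_]_(_ in _) _)%E.
have kpos : 0 < (2 * pi : R)^-1 by rewrite invr_gt0.
move: NB; case: (counting_N f r) => [v| |]//=; last first.
  by rewrite leye_eq andbF.
rewrite !lee_fin => /andP[v0 vB].
case: I => [w| |]//= hI; last first.
  by rewrite gt0_muley ?lte_fin// addey// invey mule0 lee_fin invr_ge0 addr_ge0// ltW.
rewrite lee_fin in hI.
have hw : c' * v <= (2 * pi)^-1 * w.
  apply: (@le_trans _ _ ((2 * pi)^-1 * (delta * (c * B r)))); last by rewrite ler_pM2l.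
  rewrite (_ : _ * (_ * _) = c' * B r); last by rewrite /c'; ring.
  by rewrite ler_pM2l.
have w0 : 0 < (2 * pi)^-1 * w.
  by rewrite mulr_gt0// (lt_le_trans _ hI)// !mulr_gt0.
rewrite -EFinM -EFinD inver gt_eqF; last by rewrite ltr_wpDl.
rewrite -EFinM lee_fin ler_pdivrMr; last by rewrite ltr_wpDl.
rewrite mulrC ler_pdivlMr; last by rewrite addr_gt0.
lra.
Qed.

End Deficiency.

(** * Estimates drawn from the Hadamard representation *)

Section Summability.
Variable R : realType.
Variables (K : set nat) (a : nat -> R[i]).

Lemma near_pinfty_gt (P : R -> Prop) (M : R) :
  (forall r, M < r -> P r) -> \forall r \near +oo, P r.
Proof. by move=> h; exists M; split => //; exact: num_real. Qed.

Lemma inverse_powers_bounded p : inverse_power_summable K a p ->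
  exists2 C, 0 <= C &
    forall N, \sum_(0 <= k < N | k \in K) (cmod (a k))^-1 ^+ p <= C.
Proof.
rewrite /inverse_power_summable /summable => h.
have g0 k : 0 <= (cmod (a k))^-1 ^+ p by rewrite exprn_ge0// invr_ge0 cmod_ge0.
rewrite (eq_esum (b := fun k => ((cmod (a k))^-1 ^+ p)%:E)) in h; last first.
  by move=> k _; rewrite gee0_abs// lee_fin.
have e0 : (0 <= \esum_(k in K) ((cmod (a k))^-1 ^+ p)%:E)%E.
  by apply: esum_ge0 => k _; rewrite lee_fin.
exists (fine (\esum_(k in K) ((cmod (a k))^-1 ^+ p)%:E)%E).
  exact: fine_ge0.
move=> N; rewrite -lee_fin fineK ?ge0_fin_numE// -sumEFin.
rewrite [X in (_ <= esum X _)%E](_ : K = [set k | k \in K]); last by rewrite set_mem_set.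
rewrite -nneseries_esum; last first.
  by move=> k _; rewrite lee_fin.
by apply: nneseries_lim_ge => k _ _; rewrite lee_fin.
Qed.

Lemma inverse_powers_unbounded p : ~ inverse_power_summable K a p ->
  forall A : R, exists N, A < \sum_(0 <= k < N | k \in K) (cmod (a k))^-1 ^+ p.
Proof.
move=> h A; apply: contrapT => /forallNP hN; apply: h.
have g0 k : 0 <= (cmod (a k))^-1 ^+ p by rewrite exprn_ge0// invr_ge0 cmod_ge0.
rewrite /inverse_power_summable /summable.
rewrite (eq_esum (b := fun k => ((cmod (a k))^-1 ^+ p)%:E)); last first.
  by move=> k _; rewrite gee0_abs// lee_fin.
apply: (@le_lt_trans _ _ A%:E); last by rewrite ltry.
apply: esum_nat_le => [k _|N]; first exact: g0.
by rewrite leNgt; apply/negP; exact: hN.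
Qed.

Lemma cmod_zero_gt0 (f : R[i] -> R[i]) : enumerates_nonzero_zeros f K a ->
  forall k, k \in K -> 0 < cmod (a k).
Proof.
move=> [an0 _] k kK; rewrite lt_neqAle cmod_ge0 andbT eq_sym.
by apply/eqP => /cmod_eq0; exact: (an0 k (set_mem kK)).
Qed.

End Summability.

Section Approximants.
Variable R : realType.
Variables (f : R[i] -> R[i]) (n : nat) (Q : {poly R[i]}) (K : set nat).
Variables (a : nat -> R[i]) (m : nat).
Hypothesis rep : hadamard_representation f n Q K a m.

(** At z = a_k the factor of index k vanishes, so the approximating products
    are eventually 0. *)
Lemma hadamard_zero k : K k -> f (a k) = 0.
Proof.
case: rep => -[an0 _] _ _ cvf Kk.
apply: cmod_eq0; apply/eqP; rewrite eq_le cmod_ge0 andbT.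
apply: (cvgr_to_le (cvg_cmod (cvf (a k)))).
exists k.+1 => // N /= kN.
rewrite [X in cmod (_ * X)](_ : _ = 0) ?mulr0 ?cmod0//.
rewrite big_mkord (bigD1 (Ordinal kN)) /=; last exact: mem_set.
rewrite divff; last exact/eqP/an0.
by rewrite /primary_factor subrr !mul0r.
Qed.

Hypothesis f_real_zeros : forall z : R[i], f z = 0 -> complex.Im z = 0.

Lemma zero_real k : K k -> a k = (complex.Re (a k))%:C.
Proof.
move=> /hadamard_zero/f_real_zeros; case: (a k) => x y /= ->.
by [].
Qed.

Lemma cmod_approximant N r theta : sin theta != 0 -> 0 <= r ->
  let z := circle_point r theta in
  cmod (z ^+ n * cexp Q.[z] * \prod_(0 <= k < N | k \in K) primary_factor m (z / a k))
  = r ^+ n * expR (complex.Re Q.[z] +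
      \sum_(0 <= k < N | k \in K) ln_primary m theta (r / complex.Re (a k))).
Proof.
move=> s0 r0 z; rewrite 2!cmodM cmodX cmod_circle_point ger0_norm// cmod_cexp.
rewrite -mulrA expRD cmod_prod expR_sum; congr (_ * (_ * _)).
apply: eq_bigr => k kK; rewrite (zero_real (set_mem kK)) /=.
exact: cmod_primary_factor.
Qed.

(** The product converges only pointwise, so bounds on |f| are obtained for
    the partial products and passed to the limit. *)
Lemma cmod_hadamard_le (M r theta : R) : sin theta != 0 -> 0 <= r ->
  (\forall N \near \oo, r ^+ n * expR (complex.Re Q.[circle_point r theta] +
      \sum_(0 <= k < N | k \in K) ln_primary m theta (r / complex.Re (a k))) <= M) ->
  cmod (f (circle_point r theta)) <= M.
Proof.
move=> s0 r0 hM; case: rep => _ _ _ /(_ (circle_point r theta)) cvf.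
apply: (cvgr_to_le (cvg_cmod cvf)); apply: filterS hM => N.
by rewrite cmod_approximant.
Qed.

Lemma cmod_hadamard_pair_le (M r theta phi : R) :
  sin theta != 0 -> sin phi != 0 -> 0 <= r ->
  (\forall N \near \oo, r ^+ (2 * n) *
     expR ((complex.Re Q.[circle_point r theta] + complex.Re Q.[circle_point r phi])
      + \sum_(0 <= k < N | k \in K) (ln_primary m theta (r / complex.Re (a k))
              + ln_primary m phi (r / complex.Re (a k)))) <= M) ->
  cmod (f (circle_point r theta)) * cmod (f (circle_point r phi)) <= M.
Proof.
move=> s1 s2 r0 hM; case: rep => _ _ _ cvf.
apply: (cvgr_to_le (cvgM (cvg_cmod (cvf (circle_point r theta)))
  (cvg_cmod (cvf (circle_point r phi))))).
apply: filterS hM => N; apply: le_trans => /=.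
rewrite !cmod_approximant// mulrACA -exprD -expRD addnn mul2n.
by rewrite addrACA -big_split.
Qed.

Lemma norm_div_Re_zero k r : K k -> 0 <= r ->
  `|r / complex.Re (a k)| = r * (cmod (a k))^-1.
Proof.
move=> Kk r0.
by rewrite normrM normfV (ger0_norm r0) -cmod_real -(zero_real Kk).
Qed.

End Approximants.

Section Polynomial_part.
Variable R : realType.

Lemma Re_horner_circle (Q : {poly R[i]}) (d : nat) :
  (size Q <= d.+1)%N -> (0 < d)%N ->
  exists2 C, 0 <= C & forall r theta : R, 1 <= r ->
   complex.Re Q.[circle_point r theta] <=
    r ^+ d * (complex.Re Q`_d * cos (d%:R * theta) - complex.Im Q`_d * sin (d%:R * theta))
    + C * r ^+ d.-1.
Proof.
move=> sQ d0; exists (\sum_(i < d) cmod Q`_i); first by apply: sumr_ge0 => i _; exact: cmod_ge0.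
move=> r theta r1; have r0 : 0 <= r by rewrite (le_trans _ r1).
rewrite (horner_coef_wide _ sQ) big_ord_recr /= ReD circle_pointX Re_coef_circle.
rewrite addrC lerD2l Re_sum mulr_suml; apply: ler_sum => i _.
rewrite circle_pointX (le_trans (ler_norm _))// (le_trans (Re_coef_circle_le _ _ _))//.
rewrite ler_wpM2l ?cmod_ge0// ger0_norm ?exprn_ge0// ler_weXn2l//.
by rewrite -ltnS prednK.
Qed.

(** This absorbs the factor z^n into the exponential, at the order of the
    lower terms of Q. *)
Lemma exprn_le_expR (r : R) n d : 1 <= r -> (0 < d)%N ->
  r ^+ n <= expR (n%:R * r ^+ d).
Proof.
move=> r1 d0; rewrite expRM_natl lerXn2r ?nnegrE ?expR_ge0 ?(le_trans _ r1)//.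
apply: (@le_trans _ _ (r ^+ d)); first by rewrite ler_eXnr.
by rewrite (le_trans _ (expR_ge1Dx _))// lerDr.
Qed.

End Polynomial_part.

Section Little_o.
Variable R : realType.

Lemma ln1D_le_sqrt (y : R) : 0 <= y -> ln (1 + y) <= 2 * Num.sqrt y.
Proof.
move=> y0; have s0 := sqrtr_ge0 y.
have s1 : 0 < 1 + Num.sqrt y by rewrite ltr_pwDl.
apply: (@le_trans _ _ (ln ((1 + Num.sqrt y) ^+ 2))).
  rewrite ler_ln ?posrE ?exprn_gt0 ?ltr_pwDl//.
  by rewrite sqrrD expr1n sqr_sqrtr// mul1r lerD2r lerDl mulrn_wge0.
have : ln (1 + Num.sqrt y) <= Num.sqrt y by rewrite le_ln1Dx//; lra.
by rewrite lnXn// mulr2n => ?; lra.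
Qed.

(** Cut the sum at an index N0 beyond which the x_k^(m+1) add up to at most
    e/2. The tail is bounded through ln(1 + y) <= y, and each of the N0 first
    terms is O(r^(m+1/2)) because ln(1 + y) <= 2 sqrt y. *)
Lemma sum_log_little_o (P : pred nat) (x : nat -> R) (m : nat) (C : R) :
  (forall k, 0 <= x k) ->
  (forall N, \sum_(0 <= k < N | P k) x k ^+ m.+1 <= C) ->
  forall e, 0 < e -> exists2 M, 0 < M & forall r, M < r -> forall N,
    \sum_(0 <= k < N | P k) (r * x k) ^+ m * ln (1 + r * x k) <= e * r ^+ m.+1.
Proof.
move=> x0 xC e e0.
pose S N := \sum_(0 <= k < N | P k) x k ^+ m.+1.
have hS : has_sup (range S).
  by split; [exists (S 0%N); exists 0%N|exists C => _ [N _ <-]; exact: xC].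
have e20 : 0 < e / 2 by rewrite divr_gt0.
have [_ [N0 _ <-] SN0] := sup_adherent e20 hS.
have Ssup N : S N <= sup (range S) by apply: sup_ubound; [case: hS|exists N].
pose A := \sum_(0 <= k < N0 | P k) 2 * (x k ^+ m * Num.sqrt (x k)).
have A0 : 0 <= A.
  by apply: sumr_ge0 => k _; rewrite !mulr_ge0 ?exprn_ge0 ?sqrtr_ge0.
exists ((A / (e / 2) + 1) ^+ 2); first by rewrite exprn_gt0// ltr_wpDl// divr_ge0// ltW.
move=> r Mr N; have r0 : 0 < r by rewrite (le_lt_trans _ Mr)// sqr_ge0.
have rx0 k : 0 <= r * x k by rewrite mulr_ge0// ltW.
have g0 k : 0 <= (r * x k) ^+ m * ln (1 + r * x k).
  by rewrite mulr_ge0 ?exprn_ge0// ln_ge0// lerDl.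
apply: (@le_trans _ _ (\sum_(0 <= k < maxn N0 N | P k) (r * x k) ^+ m * ln (1 + r * x k))).
  rewrite [leRHS](@big_cat_nat _ _ _ N)/= ?leq_maxr//.
  by rewrite lerDl sumr_ge0.
rewrite (@big_cat_nat _ _ _ N0)/= ?leq_maxl//.
rewrite [e]splitr mulrDl lerD//.
- apply: (@le_trans _ _ (r ^+ m * Num.sqrt r * A)).
    rewrite mulr_sumr; apply: ler_sum => k _.
    rewrite [leRHS](_ : _ = (r * x k) ^+ m * (2 * (Num.sqrt r * Num.sqrt (x k)))); last first.
      by rewrite exprMn; ring.
    rewrite -sqrtrM ?(ltW r0)// ler_wpM2l ?exprn_ge0//.
    exact: ln1D_le_sqrt.
  rewrite exprSr mulrCA -mulrA ler_wpM2l ?exprn_ge0 ?(ltW r0)//.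
  rewrite -{2}[r]sqr_sqrtr ?(ltW r0)// expr2 mulrCA ler_wpM2l ?sqrtr_ge0//.
  rewrite -ler_pdivrMl// mulrC.
  have : A / (e / 2) + 1 < Num.sqrt r.
    rewrite -[ltLHS]ger0_norm; last by rewrite addr_ge0// divr_ge0// ltW.
    by rewrite -sqrtr_sqr ltr_sqrt.
  lra.
- apply: (@le_trans _ _ (r ^+ m.+1 * (S (maxn N0 N) - S N0))).
    rewrite [S (maxn _ _)](@big_cat_nat _ _ _ N0)/= ?leq_maxl//.
    rewrite -/(S N0) [S N0 + _ - _]addrAC subrr add0r.
    rewrite mulr_sumr; apply: ler_sum => k _.
    rewrite -exprMn exprSr ler_wpM2l ?exprn_ge0// le_ln1Dx//.
    by have := rx0 k; lra.
  rewrite mulrC ler_pM2r ?exprn_gt0//.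
  have := Ssup (maxn N0 N); lra.
Qed.

End Little_o.

(** The rate is B itself, the majorant of N(r), because the defect compares the
    decay with N(r); c is independent of r. *)
Definition paired_decay (R : realType) (f : R[i] -> R[i]) (theta delta c : R)
    (B : R -> R) : Prop :=
  [/\ [/\ 0 < delta, 0 <= theta - delta, theta + delta <= 2 * pi & 0 < c],
      B r @[r --> +oo] --> +oo,
      \forall r \near +oo, (0 <= counting_N f r <= (B r)%:E)%E
    & \forall r \near +oo, forall phi, 0 <= phi <= delta ->
        cmod (f (circle_point r (theta + phi)))
          * cmod (f (circle_point r (theta - phi))) <= expR (- (c * B r))].

(** * The exponential factor dominates *)

Section Descent_arc.
Variable R : realType.

Lemma negative_direction (x y : R) : (x != 0) || (y != 0) ->
  exists2 psi, 0 < psi < 2 * pi & x * cos psi - y * sin psi < 0.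
Proof.
have pi0 := pi_gt0 R.
have [y0|y0|->] := ltgtP y 0 => h.
- exists (pi + pi / 2); first by apply/andP; split; lra.
  by rewrite cosDpihalf sinDpihalf sinpi cospi oppr0 mulr0; lra.
- exists (pi / 2); first by apply/andP; split; lra.
  by rewrite cos_pihalf sin_pihalf mulr0; lra.
have [x0|x0|x0] := ltgtP x 0.
- exists (pi / 4); first by apply/andP; split; lra.
  rewrite mul0r subr0 nmulr_rlt0// cos_gt0_pihalf//.
  by apply/andP; split; lra.
- exists pi; first by apply/andP; split; lra.
  by rewrite cospi mul0r; lra.
- by move: h; rewrite x0 eqxx.
Qed.

(** Dividing the angle of [negative_direction] by the degree q lands in
    (0, pi) because q >= 2, so the genus hypothesis is what keeps the arc away
    from the real axis, where the estimates of a primary factor degenerate. *)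
Lemma descent_arc (x y : R) (q : nat) : (x != 0) || (y != 0) -> (2 <= q)%N ->
  exists theta delta kappa s, [/\ 0 < delta, 0 < kappa, 0 < s &
    forall t, `|theta - t| <= delta ->
      [/\ x * cos (q%:R * t) - y * sin (q%:R * t) <= - kappa,
          s <= sin t & 0 < t < pi]].
Proof.
move=> xy0 q2; have [psi /andP[psi0 psi2] psin] := negative_direction xy0.
have qR : 2 <= (q%:R : R) by rewrite ler_nat.
have qR0 : 0 < (q%:R : R) by lra.
pose t0 : R := psi / q%:R.
have qt0 : q%:R * t0 = psi by rewrite mulrC divfK ?gt_eqF.
have t0gt : 0 < t0 by rewrite divr_gt0.
have t0lt : t0 < pi.
  have h : pi * 2 <= pi * q%:R :> R by rewrite ler_pM2l ?pi_gt0.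
  by rewrite ltr_pdivrMr//; lra.
have sin0 : 0 < sin t0 by apply: sin_gt0_pi; rewrite t0gt.
pose G (t : R) : R := x * cos (q%:R * t) - y * sin (q%:R * t).
have G0 : G t0 < 0 by rewrite /G qt0.
have cG : {for t0, continuous G}.
  have cq : {for t0, continuous (fun t : R => q%:R * t)}.
    by apply: cvgM; [exact: cvg_cst|exact: cvg_id].
  apply: cvgB; (apply: cvgM; first exact: cvg_cst).
    exact: (cvg_comp _ _ cq (@continuous_cos R _)).
  exact: (cvg_comp _ _ cq (@continuous_sin R _)).
have : \forall t \near t0,
    [/\ G t < G t0 / 2, sin t0 / 2 < sin t, 0 < t & t < pi].
  near=> t; split; near: t.
  - by apply: (cvgr_lt _ cG); lra.
  - by apply: (cvgr_gt _ (@continuous_sin R t0)); lra.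
  - exact: lt_nbhsr.
  - exact: lt_nbhsl.
move=> /nbhs_ballP[d /= d0 hd].
exists t0, (d / 2), (- (G t0 / 2)), (sin t0 / 2); split; [lra|lra|lra|].
move=> t tt; have [|Gt st t_gt0 t_ltpi] := hd t.
  by rewrite /ball /=; lra.
by rewrite opprK t_gt0 t_ltpi !ltW.
Unshelve. all: by end_near.
Qed.

End Descent_arc.

Section Exponential_dominates.
Variable R : realType.
Variables (f : R[i] -> R[i]) (n : nat) (Q : {poly R[i]}) (K : set nat).
Variables (a : nat -> R[i]) (m : nat).
Hypothesis rep : hadamard_representation f n Q K a m.
Hypothesis f_real_zeros : forall z : R[i], f z = 0 -> complex.Im z = 0.

(** With deg Q = q > m the leading term of Q contributes -kappa r^q on the
    arc, while the canonical product is o(r^(m+1)), hence o(r^q), there. Here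
    both rays of a pair decay separately. *)
Lemma paired_decay_exponential :
  (m < (size Q).-1)%N -> (2 <= (size Q).-1)%N ->
  exists theta delta c B, paired_decay f theta delta c B.
Proof.
set q := (size Q).-1 => mq q2.
have q0 : (0 < q)%N by rewrite (leq_trans _ q2).
have q1 : (0 < q.-1)%N by rewrite -ltnS prednK.
have sQ : (size Q <= q.+1)%N by rewrite leqSpred.
have Qn0 : Q != 0 by apply: contraTneq q2 => Q0; rewrite /q Q0 size_poly0.
have cn0 : Q`_q != 0 by rewrite -[Q`_q]/(lead_coef Q) lead_coef_eq0.
have xy0 : (complex.Re Q`_q != 0) || (complex.Im Q`_q != 0).
  by case: (Q`_q) cn0 => u v /=; rewrite eq_complex /= negb_and.
have [t0 [del [kap [s [del0 kap0 s0 arc]]]]] := descent_arc xy0 q2.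
have [C C0 hC] : exists2 C, 0 <= C &
    forall N, \sum_(0 <= k < N | k \in K) (cmod (a k))^-1 ^+ m.+1 <= C.
  by case: rep => _ sm _ _; exact: inverse_powers_bounded.
have x0 k : 0 <= (cmod (a k))^-1 by rewrite invr_ge0 cmod_ge0.
(* e is the smallness that lets the constant 4 / s^2 of ln_primary_le be
   absorbed in a quarter of kappa *)
have [e e0 he] : exists2 e, 0 < e & 4 / s ^+ 2 * e = kap / 4.
  exists (kap / 4 * (s ^+ 2 / 4)); first by rewrite !mulr_gt0// exprn_gt0.
  by field; rewrite gt_eqF.
have [M M0 hM] := sum_log_little_o (P := fun k => k \in K) x0 hC e0.
have [D D0 hD] := Re_horner_circle sQ q0.
pose r0 := Num.max M (Num.max 1 (4 * (n%:R + D) / kap)).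
have bound r theta : r0 < r -> `|t0 - theta| <= del ->
    cmod (f (circle_point r theta)) <= expR (- (kap / 2 * r ^+ q)).
  rewrite !gt_max => /and3P[Mr r1 rD] /arc [Gt st _].
  have r00 : 0 <= r by lra.
  have sn0 : sin theta != 0 by rewrite gt_eqF// (lt_le_trans s0).
  apply: (cmod_hadamard_le rep f_real_zeros sn0 r00); apply: nearW => N.
  apply: (le_trans (ler_wpM2r (expR_ge0 _) (exprn_le_expR n (ltW r1) q1))).
  rewrite -expRD ler_expR.
  have sumE : \sum_(0 <= k < N | k \in K) ln_primary m theta (r / complex.Re (a k))
       <= kap / 4 * r ^+ q.
    apply: (@le_trans _ _ (4 / s ^+ 2 * \sum_(0 <= k < N | k \in K)
       (r * (cmod (a k))^-1) ^+ m * ln (1 + r * (cmod (a k))^-1))).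
      rewrite mulr_sumr; apply: ler_sum => k kK.
      rewrite -(norm_div_Re_zero rep f_real_zeros (set_mem kK) r00).
      by apply: ln_primary_le => //; rewrite (le_trans st)// ler_norm.
    rewrite -he -[leRHS]mulrA ler_wpM2l//; first by rewrite divr_ge0// sqr_ge0.
    apply: (le_trans (hM r Mr N)); rewrite ler_wpM2l ?(ltW e0)//.
    by rewrite ler_weXn2l// ltW.
  have ReQ := hD r theta (ltW r1).
  have rq : r ^+ q = r * r ^+ q.-1 by rewrite -exprS prednK.
  have rq0 : 0 < r ^+ q.-1 by rewrite exprn_gt0// (lt_trans _ r1).
  have lower : (n%:R + D) * r ^+ q.-1 <= kap / 4 * r ^+ q.
    rewrite rq mulrA ler_pM2r//.
    by move: rD; rewrite ltr_pdivrMr// => ?; lra.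
  have main := ler_wpM2l (exprn_ge0 q r00) Gt.
  lra.
have C1 : 0 < C + 1 by lra.
exists t0, del, (kap / (C + 1)), (fun r => (C + 1) * r ^+ q); split.
- have dlo : `|t0 - (t0 - del)| <= del.
    by rewrite opprB addrC subrK ger0_norm// ltW.
  have dhi : `|t0 - (t0 + del)| <= del.
    by rewrite opprD addrA subrr add0r normrN ger0_norm// ltW.
  have [_ _ /andP[lo _]] := arc _ dlo; have [_ _ /andP[_ hi]] := arc _ dhi.
  have pi0 := pi_gt0 R.
  by split; [exact: del0|exact: ltW|lra|exact: divr_gt0].
- apply/cvgryPge => A; apply: (@near_pinfty_gt _ _ (Num.max 1 A)) => r.
  rewrite gt_max => /andP[r1 rA].
  have r0' : 0 <= r by lra.
  apply: (le_trans (ltW rA)); apply: (@le_trans _ _ (r ^+ q)).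
    by rewrite ler_eXnr// ltW.
  by rewrite ler_peMl ?exprn_ge0//; lra.
- apply: (@near_pinfty_gt _ _ 1) => r r1; have r00 : 0 < r by lra.
  case: rep => zeros _ _ _; apply: (counting_N_ge0_le zeros r00) => N.
  apply: (@le_trans _ _ (r ^+ m.+1 * \sum_(0 <= k < N | k \in K) (cmod (a k))^-1 ^+ m.+1)).
    rewrite mulr_sumr big_mkcond [leRHS]big_mkcond; apply: ler_sum => k _.
    rewrite -exprMn; case: ifPn => [/andP[kK akr]|_].
      rewrite kK ler_eXnr// ler_pdivlMr ?mul1r//.
      exact: (cmod_zero_gt0 zeros).
    by case: ifP => // _; rewrite exprn_ge0// mulr_ge0// ltW.
  rewrite mulrC; apply: ler_pM.
  + by apply: sumr_ge0 => k _; rewrite exprn_ge0.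
  + by rewrite exprn_ge0// ltW.
  + by apply: (le_trans (hC N)); lra.
  + by rewrite ler_weXn2l// ltW.
- apply: (@near_pinfty_gt _ _ r0) => r rr0 phi /andP[p0 pd].
  rewrite mulrA divfK ?gt_eqF//.
  rewrite [kap](_ : _ = kap / 2 + kap / 2); last by field.
  rewrite mulrDl opprD expRD ler_pM ?cmod_ge0//; apply: bound => //.
    by rewrite opprD addrA subrr add0r normrN ger0_norm.
  by rewrite opprB addrC subrK ger0_norm.
Qed.

End Exponential_dominates.

(** * The canonical product dominates *)

Section Decay_kernel.
Variable R : realType.
Implicit Types (p m : nat) (y : R).

Lemma decay_kernel_ge0 p y : 0 <= y -> 0 <= decay_kernel p y.
Proof. by move=> y0; rewrite divr_ge0 ?exprn_ge0// addr_ge0// sqr_ge0. Qed.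

Lemma decay_kernel_ge p y :
  (0 < p)%N -> 1 <= y -> y ^+ p.-1 / 2 <= decay_kernel p y.
Proof.
move=> p0 y1; have y0 : 0 <= y by lra.
have d0 : 0 < 1 + y ^+ 2 by rewrite ltr_pwDl// sqr_ge0.
rewrite /decay_kernel.
have -> : y ^+ p.+1 = y ^+ p.-1 * y ^+ 2 by rewrite -exprD addn2 prednK.
rewrite ler_pdivlMr// -mulrA ler_wpM2l ?exprn_ge0//.
have : 0 <= (y - 1) * (y + 1) by rewrite mulr_ge0//; lra.
lra.
Qed.

Lemma decay_kernel_le_exprS p y : 0 <= y -> decay_kernel p y <= y ^+ p.+1.
Proof.
move=> y0; have d0 : 0 < 1 + y ^+ 2 by rewrite ltr_pwDl// sqr_ge0.
rewrite ler_pdivrMr// ler_peMr ?exprn_ge0// lerDl; exact: sqr_ge0.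
Qed.

Lemma decay_kernel_le_expr p y : 0 <= y -> decay_kernel p y <= y ^+ p.
Proof.
move=> y0; have d0 : 0 < 1 + y ^+ 2 by rewrite ltr_pwDl// sqr_ge0.
rewrite ler_pdivrMr// exprSr ler_wpM2l ?exprn_ge0//.
by have := sqr_ge0 (y - 1); lra.
Qed.

(** E(u, p+1) and E(u, p) differ by the factor exp(u^(p+1)/(p+1)), whose
    contributions on the two rays of a pair are opposite when
    cos((p+1) theta) = 0. Hence a single odd exponent serves an even genus
    and the odd one after it. *)
Lemma ln_primary_pair_parity p (theta phi t : R) : cos (p.+1%:R * theta) = 0 ->
  ln_primary p.+1 (theta + phi) t + ln_primary p.+1 (theta - phi) t
    = ln_primary p (theta + phi) t + ln_primary p (theta - phi) t.
Proof.
move=> c0; rewrite !ln_primaryS mulrDr mulrBr cosD cosB c0.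
by ring.
Qed.

(** The ray theta = 3 pi / (2 p), where p theta is three quarters of a turn,
    satisfies the hypotheses of [ln_primary_pair_le] for all small phi. It lies
    in (0, pi) because p >= 3, that is, because the genus is at least 2. *)
Lemma canonical_direction p : (3 <= p)%N -> exists theta delta s : R,
  [/\ 0 < delta < theta, theta < pi, 0 < s,
      cos (p%:R * theta) = 0 /\ sin (p%:R * theta) = -1
    & forall phi, 0 <= phi <= delta ->
      [/\ s <= sin (theta + p.+1%:R * phi) /\ s <= sin (theta - p.+1%:R * phi),
          s <= sin (theta + phi) /\ s <= sin (theta - phi),
          0 <= sin phi, 0 <= sin (p%:R * phi) & 0 <= cos (p%:R * phi)]].
Proof.
move=> p3; have pi0 := pi_gt0 R.
have pR3 : 3 <= (p%:R : R) by rewrite ler_nat.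
have pR0 : 0 < (p%:R : R) by lra.
pose t0 : R := (pi + pi / 2) / p%:R.
have pt0 : p%:R * t0 = pi + pi / 2 by rewrite mulrC divfK ?gt_eqF.
have t0gt : 0 < t0 by rewrite divr_gt0//; lra.
have t0lt : t0 < pi.
  have h : pi * 3 <= pi * p%:R :> R by rewrite ler_pM2l.
  by rewrite ltr_pdivrMr//; lra.
have sin0 : 0 < sin t0 by apply: sin_gt0_pi; rewrite t0gt.
have csin (b : R) : \forall phi \near (0 : R), sin t0 / 2 < sin (t0 + b * phi).
  have cb : {for 0, continuous (fun phi : R => t0 + b * phi)}.
    by apply: cvgD; [exact: cvg_cst|apply: cvgM; [exact: cvg_cst|exact: cvg_id]].
  apply: (cvgr_gt _ (cvg_comp _ _ cb (@continuous_sin R _))).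
  by rewrite mulr0 addr0; lra.
have : \forall phi \near (0 : R), [/\ sin t0 / 2 < sin (t0 + p.+1%:R * phi),
    sin t0 / 2 < sin (t0 + - p.+1%:R * phi), sin t0 / 2 < sin (t0 + 1 * phi)
  & sin t0 / 2 < sin (t0 + -1 * phi)].
  by near=> phi; split; near: phi; exact: csin.
move=> /nbhs_ballP[d /= d0 hd].
pose del := Num.min (d / 2) (pi / 2 / p%:R).
have del_d : del <= d / 2 by rewrite ge_min lexx.
have del_pi : del <= pi / 2 / p%:R by rewrite ge_min lexx orbT.
exists t0, del, (sin t0 / 2); split => //.
- rewrite lt_min !divr_gt0//= (le_lt_trans del_pi)//.
  by rewrite ltr_pM2r ?invr_gt0//; lra.
- by lra.
- by rewrite pt0 cosDpihalf sinpi oppr0 sinDpihalf cospi.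
move=> phi /andP[ph0 phd].
have [|h1 h2 h3 h4] := hd phi.
  by rewrite /ball /= sub0r normrN ger0_norm//; lra.
rewrite mulNr in h2; rewrite mul1r in h3; rewrite mulN1r in h4.
have pphi : p%:R * phi <= pi / 2.
  by rewrite mulrC -ler_pdivlMr// (le_trans phd).
have pphi0 : 0 <= p%:R * phi by rewrite mulr_ge0// ltW.
have phi1 : phi <= p%:R * phi by rewrite ler_peMl//; lra.
split; [by split; exact: ltW|by split; exact: ltW| | |].
- by apply: sin_ge0_pi; apply/andP; split; lra.
- by apply: sin_ge0_pi; apply/andP; split; lra.
- by apply: cos_ge0_pihalf; apply/andP; split; lra.
Unshelve. all: by end_near.
Qed.

End Decay_kernel.

Definition partial_kernel_sum (R : realType) (K : set nat) (a : nat -> R[i])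
    (p : nat) (r : R) (N : nat) : R :=
  \sum_(0 <= k < N | k \in K) decay_kernel p (r / cmod (a k)).

Definition kernel_sum (R : realType) (K : set nat) (a : nat -> R[i]) (p : nat)
    (r : R) : R :=
  sup (range (partial_kernel_sum K a p r)).

Section Kernel_sums.
Variable R : realType.
Variables (K : set nat) (a : nat -> R[i]) (p m : nat).
Hypothesis p0 : (0 < p)%N.
Hypothesis a0 : forall k, k \in K -> 0 < cmod (a k).
Hypothesis kernel_le : forall y : R, 0 <= y -> decay_kernel p y <= y ^+ m.+1.
Hypothesis summ : inverse_power_summable K a m.+1.
Local Notation psum := (partial_kernel_sum K a p).

Let ratio_ge0 (r : R) k : 0 <= r -> 0 <= r / cmod (a k).
Proof. by move=> r0; rewrite divr_ge0// cmod_ge0. Qed.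

Lemma has_sup_partial_kernel_sum (r : R) : 0 <= r -> has_sup (range (psum r)).
Proof.
move=> r0; split; first by exists (psum r 0%N); exists 0%N.
have [C _ hC] := inverse_powers_bounded summ.
exists (C * r ^+ m.+1) => _ [N _ <-].
apply: (@le_trans _ _ (r ^+ m.+1 *
  \sum_(0 <= k < N | k \in K) (cmod (a k))^-1 ^+ m.+1)).
  rewrite mulr_sumr; apply: ler_sum => k _; rewrite -exprMn.
  by apply: kernel_le; exact: ratio_ge0.
by rewrite mulrC ler_wpM2r ?exprn_ge0.
Qed.

Lemma partial_kernel_sum_le (r : R) N : 0 <= r -> psum r N <= kernel_sum K a p r.
Proof.
by move=> r0; apply: sup_ubound; [case: (has_sup_partial_kernel_sum r0)|exists N].
Qed.

Lemma partial_kernel_sum_ge_half (r : R) : 0 <= r -> 0 < kernel_sum K a p r ->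
  \forall N \near \oo, kernel_sum K a p r / 2 <= psum r N.
Proof.
move=> r0 S0.
have [_ [N0 _ <-] hN0] :=
  sup_adherent (divr_gt0 S0 (ltr0n _ 2)) (has_sup_partial_kernel_sum r0).
exists N0 => // N /= NN0; apply: (@le_trans _ _ (psum r N0)).
  by rewrite -/(kernel_sum K a p r) in hN0; lra.
rewrite [leRHS](@big_cat_nat _ _ _ N0)//= lerDl sumr_ge0// => k _.
by apply: decay_kernel_ge0; exact: ratio_ge0.
Qed.

(** On the zeros of modulus at most r the kernel is at least
    (r/|a_k|)^(p-1) / 2, so divergence of the series of |a_k|^-(p-1) makes
    the kernel sum of larger order than r^(p-1). *)
Lemma kernel_sum_large : ~ inverse_power_summable K a p.-1 ->
  forall A : R, exists2 M, 1 < M &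
    forall r, M < r -> A * r ^+ p.-1 <= kernel_sum K a p r.
Proof.
move=> diverge A; have [N hN] := inverse_powers_unbounded diverge (2 * A).
have sum0 : 0 <= \sum_(0 <= k < N) cmod (a k).
  by rewrite sumr_ge0// => k _; exact: cmod_ge0.
(* beyond this radius each of the first N zeros has modulus at most r *)
exists (2 + \sum_(0 <= k < N) cmod (a k)); first by lra.
move=> r Mr; have r0 : 0 <= r by lra.
apply: le_trans (partial_kernel_sum_le N r0).
apply: (@le_trans _ _ (r ^+ p.-1 / 2 *
    \sum_(0 <= k < N | k \in K) (cmod (a k))^-1 ^+ p.-1)).
  rewrite -mulrA mulrC ler_wpM2l ?exprn_ge0//; lra.
rewrite mulr_sumr /partial_kernel_sum !big_mkord; apply: ler_sum => k kK.
rewrite mulrAC -exprMn; apply: decay_kernel_ge => //.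
rewrite ler_pdivlMr ?mul1r ?a0//.
have : cmod (a k) <= \sum_(0 <= k < N) cmod (a k).
  by rewrite big_mkord (bigD1 k)//= lerDl sumr_ge0// => i _; exact: cmod_ge0.
lra.
Qed.

End Kernel_sums.

Section Canonical_product_dominates.
Variable R : realType.
Variables (f : R[i] -> R[i]) (n : nat) (Q : {poly R[i]}) (K : set nat).
Variables (a : nat -> R[i]) (m : nat).
Hypothesis rep : hadamard_representation f n Q K a m.
Hypothesis f_real_zeros : forall z : R[i], f z = 0 -> complex.Im z = 0.

(** The coefficient of z^p in Q is the one that the canonical product cannot
    be guaranteed to dominate when m = p. On the pair of rays
    e (theta + phi), e (theta - phi) the cosines that multiply Re Q_p cancel, and
    the sines that multiply Im Q_p leave 2 e Im Q_p cos(p phi) r^p, which is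
    nonpositive for one of the choices e = 1, e = -1. *)
Lemma Re_horner_pair p (theta e : R) :
  (size Q <= p.+1)%N -> (0 < p)%N -> e = 1 \/ e = -1 ->
  e * complex.Im Q`_p <= 0 ->
  cos (p%:R * theta) = 0 -> sin (p%:R * theta) = -1 ->
  exists2 D, 0 <= D & forall r phi : R, 1 <= r -> 0 <= cos (p%:R * phi) ->
    complex.Re Q.[circle_point r (e * (theta + phi))]
      + complex.Re Q.[circle_point r (e * (theta - phi))] <= D * r ^+ p.-1.
Proof.
move=> sQ p0 e1 ey cp sp; have [D D0 hD] := Re_horner_circle sQ p0.
exists (2 * D) => [|r phi r1 cphi]; first by lra.
have := hD r (e * (theta + phi)) r1; have := hD r (e * (theta - phi)) r1.
have cose x : cos (e * x) = cos x.
  by case: e1 => ->; rewrite ?mul1r// mulN1r cosN.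
have sine x : sin (e * x) = e * sin x.
  by case: e1 => ->; rewrite ?mul1r// !mulN1r sinN.
rewrite ![p%:R * (e * _)]mulrCA !cose !sine.
rewrite [p%:R * (theta + phi)]mulrDr [p%:R * (theta - phi)]mulrBr.
rewrite cosB cosD sinB sinD cp sp.
have : r ^+ p * (e * complex.Im Q`_p * cos (p%:R * phi)) <= 0.
  apply: mulr_ge0_le0; first by rewrite exprn_ge0//; lra.
  exact: mulr_le0_ge0.
move: (complex.Re Q`_p) (complex.Im Q`_p) (r ^+ p) (r ^+ p.-1) => x y rp rp1.
by move=> h0 h1 h2; lra.
Qed.

Lemma sum_ln_primary_pair_le p (theta phi s e r : R) N :
  p = m \/ p = m.+1 -> odd p -> e = 1 \/ e = -1 -> 0 <= r ->
  cos (p%:R * theta) = 0 -> sin (p%:R * theta) = -1 ->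
  0 <= sin theta -> 0 <= sin phi -> 0 <= sin (p%:R * phi) ->
  sin (theta + phi) != 0 -> sin (theta - phi) != 0 -> 0 < s ->
  s <= sin (theta + p.+1%:R * phi) -> s <= sin (theta - p.+1%:R * phi) ->
  \sum_(0 <= k < N | k \in K)
    (ln_primary m (e * (theta + phi)) (r / complex.Re (a k))
     + ln_primary m (e * (theta - phi)) (r / complex.Re (a k)))
  <= - (s / p.+1%:R) * partial_kernel_sum K a p r N.
Proof.
move=> pm op e1 r0 cp sp st sphi spphi n1 n2 s0 s1 s2.
have even x t : ln_primary m (e * x) t = ln_primary m x t.
  by case: e1 => ->; rewrite ?mul1r// mulN1r ln_primaryN.
rewrite mulr_sumr; apply: ler_sum => k kK; rewrite !even.
rewrite -(norm_div_Re_zero rep f_real_zeros (set_mem kK) r0) decay_kernel_norm//.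
have -> : ln_primary m (theta + phi) (r / complex.Re (a k))
    + ln_primary m (theta - phi) (r / complex.Re (a k))
  = ln_primary p (theta + phi) (r / complex.Re (a k))
    + ln_primary p (theta - phi) (r / complex.Re (a k)).
  case: pm => pm; first by rewrite pm.
  by rewrite pm ln_primary_pair_parity// -pm.
exact: ln_primary_pair_le.
Qed.

(** With deg Q <= m the kernel sum S(r) drives everything. Minimality of m makes
    the series of |a_k|^-(p-1) diverge, so S(r) dominates both z^n and the part
    of Q that survives in [Re_horner_pair]. *)
Lemma paired_decay_canonical :
  ((size Q).-1 <= m)%N -> (2 <= m)%N ->
  exists theta delta c B, paired_decay f theta delta c B.
Proof.
move=> Qm m2.
(* the odd one among m and m + 1 *)
pose p := (m./2.*2).+1.
have pm : p = m \/ p = m.+1.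
  by rewrite /p; have := odd_double_half m; case: (odd m) => /= ?; lia.
have op : odd p by rewrite /= odd_double.
have p3 : (3 <= p)%N by lia.
have p0 : (0 < p)%N by lia.
have p1 : (0 < p.-1)%N by lia.
have p2S : p.-2.+1 = p.-1 by lia.
have p2m : (p.-2 < m)%N by lia.
have sQ : (size Q <= p.+1)%N by lia.
have [t0 [del [s [/andP[del0 del_t0] t0lt s0 [cpt0 spt0] dir]]]] :=
  canonical_direction R p3.
have sin0 : 0 <= sin t0 by apply: sin_ge0_pi; apply/andP; split; lra.
have [zeros summ min _] := rep.
have kle (y : R) : 0 <= y -> decay_kernel p y <= y ^+ m.+1.
  case: pm => <-; first exact: decay_kernel_le_exprS.
  exact: decay_kernel_le_expr.
have ak0 := cmod_zero_gt0 zeros.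
have diverge : ~ inverse_power_summable K a p.-1.
  by rewrite -p2S => /min; rewrite leqNgt p2m.
have [e e1 ey] : exists2 e : R, e = 1 \/ e = -1 & e * complex.Im Q`_p <= 0.
  have [y0|y0] := leP (complex.Im Q`_p) 0.
    by exists 1; [left|rewrite mul1r].
  by exists (-1); [right|rewrite mulN1r oppr_le0 ltW].
have [D D0 hD] := Re_horner_pair sQ p0 e1 ey cpt0 spt0.
pose k := s / p.+1%:R.
have k0 : 0 < k by rewrite divr_gt0.
pose S := kernel_sum K a p.
have [M M1 hM] := kernel_sum_large p0 ak0 kle summ diverge
  (Num.max 1 (4 * (2 * n%:R + D) / k)).
have S_ge (r : R) : M < r -> r <= S r.
  move=> Mr; apply: le_trans (hM r Mr).
  apply: (@le_trans _ _ (1 * r ^+ p.-1)).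
    by rewrite mul1r ler_eXnr//; lra.
  by rewrite ler_wpM2r ?exprn_ge0 ?le_max ?lexx//; lra.
have lower (r : R) : M < r -> (2 * n%:R + D) * r ^+ p.-1 <= k / 4 * S r.
  move=> Mr; have r0 : 0 <= r by lra.
  have : (4 * (2 * n%:R + D) / k) * r ^+ p.-1 <= S r.
    apply: le_trans (hM r Mr).
    by rewrite ler_wpM2r ?exprn_ge0// le_max lexx orbT.
  by rewrite mulrAC ler_pdivrMr// => h; lra.
have en0 : e != 0 by case: e1 => ->; rewrite ?oppr_eq0 oner_eq0.
have bound (r phi : R) : M < r -> 0 <= phi <= del ->
    cmod (f (circle_point r (e * (t0 + phi))))
      * cmod (f (circle_point r (e * (t0 - phi)))) <= expR (- (k / 8 * (2 * S r))).
  move=> Mr hphi; have r1 : 1 <= r by lra.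
  have r0 : 0 <= r by lra.
  have [[a1 a2] [a3 a4] b1 b2 b3] := dir phi hphi.
  have n1 : sin (t0 + phi) != 0 by rewrite gt_eqF// (lt_le_trans s0).
  have n2 : sin (t0 - phi) != 0 by rewrite gt_eqF// (lt_le_trans s0).
  have sine x : sin (e * x) = e * sin x.
    by case: e1 => ->; rewrite ?mul1r// !mulN1r sinN.
  apply: (cmod_hadamard_pair_le rep f_real_zeros _ _ r0);
    rewrite ?sine ?mulf_neq0//.
  have Sr0 : 0 < S r by have := S_ge r Mr; lra.
  have half := partial_kernel_sum_ge_half kle summ r0 Sr0.
  apply: filterS half => N half.
  apply: (le_trans (ler_wpM2r (expR_ge0 _) (exprn_le_expR (2 * n) r1 p1))).
  rewrite -expRD ler_expR.
  have ReQ := hD r phi r1 b3.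
  have sumE := sum_ln_primary_pair_le N pm op e1 r0 cpt0 spt0 sin0 b1 b2 n1 n2 s0 a1 a2.
  have kS := ler_wpM2l (ltW k0) half.
  have low := lower r Mr.
  rewrite -/k in sumE; rewrite -/(S r) in kS; rewrite natrM.
  move: sumE kS ReQ low => /=; lra.
(* the ray of argument - theta is represented by 2 pi - theta *)
have [theta [th1 th2 hth]] : exists theta, [/\ 0 <= theta - del, theta + del <= 2 * pi &
   forall r phi, M < r -> 0 <= phi <= del ->
    cmod (f (circle_point r (theta + phi)))
      * cmod (f (circle_point r (theta - phi))) <= expR (- (k / 8 * (2 * S r)))].
  case: e1 bound => -> bound.
    exists t0; split; [lra|lra|].
    by move=> r phi Mr hphi; have := bound r phi Mr hphi; rewrite !mul1r.
  exists (- t0 + 2 * pi); split; [lra|lra|].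
  move=> r phi Mr hphi; have := bound r phi Mr hphi; rewrite !mulN1r mulrC.
  have -> : - t0 + 2 * pi + phi = - (t0 - phi) + 2 * pi by ring.
  have -> : - t0 + 2 * pi - phi = - (t0 + phi) + 2 * pi by ring.
  by rewrite !circle_point_2pi.
exists theta, del, (k / 8), (fun r => 2 * S r); split.
- by split => //; rewrite divr_gt0.
- apply/cvgryPge => A; apply: (@near_pinfty_gt _ _ (Num.max M A)) => r.
  rewrite gt_max => /andP[Mr rA].
  by have := S_ge r Mr; lra.
- apply: (@near_pinfty_gt _ _ M) => r Mr; have r0 : 0 < r by lra.
  apply: (counting_N_ge0_le zeros r0) => N.
  apply: (@le_trans _ _ (2 * partial_kernel_sum K a p r N)); last first.
    by rewrite ler_pM2l//; exact: (partial_kernel_sum_le kle summ N (ltW r0)).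
  rewrite mulr_sumr big_mkcond [leRHS]big_mkcond; apply: ler_sum => j _.
  have kj0 : 0 <= decay_kernel p (r / cmod (a j)).
    by apply: decay_kernel_ge0; rewrite divr_ge0 ?cmod_ge0// ltW.
  case: ifPn => [/andP[jK ajr]|_]; last by case: ifP => // _; rewrite mulr_ge0.
  rewrite jK; have y1 : 1 <= r / cmod (a j) by rewrite ler_pdivlMr ?mul1r ?ak0.
  have := decay_kernel_ge p0 y1.
  have : r / cmod (a j) <= (r / cmod (a j)) ^+ p.-1 by rewrite ler_eXnr.
  by move: (r / cmod (a j)) (_ ^+ _) (decay_kernel _ _) => u v w; lra.
- by apply: (@near_pinfty_gt _ _ M) => r Mr phi hphi; exact: hth.
Qed.

End Canonical_product_dominates.

(** * Conclusion *)

Section Consequences.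
Variable R : realType.
Variable f : R[i] -> R[i].

(** The genus is 0 when no representation exists. *)
Lemma genus_representation : (2 <= genus f)%N ->
  exists n Q K a m, hadamard_representation f n Q K a m /\
    (2 <= maxn m (size Q).-1)%N.
Proof.
rewrite /genus; case: xgetP => [g _ [n [Q [K [a [m [rep ->]]]]]] g2|//].
by exists n, Q, K, a, m.
Qed.

Lemma paired_decay_genus_ge2 :
  (forall z : R[i], f z = 0 -> complex.Im z = 0) -> (2 <= genus f)%N ->
  exists theta delta c B, paired_decay f theta delta c B.
Proof.
move=> real_zeros /genus_representation[n [Q [K [a [m [rep]]]]]].
have [Qm|mQ] := leqP (size Q).-1 m.
  exact: (paired_decay_canonical rep).
exact: (paired_decay_exponential rep).
Qed.

Lemma paired_decay_cvg0 theta delta c B : paired_decay f theta delta c B ->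
  f (circle_point r theta) @[r --> +oo] --> (0 : R[i]^o).
Proof.
move=> [[d0 _ _ c0] By _ hf]; apply/cvg_cmodP => e e0.
move/cvgryPgt : By => /(_ (- ln (e ^+ 2) / c)) By.
apply: filterS2 hf By => r hf Br.
have := hf 0; rewrite addr0 subr0 lexx ltW// => /(_ isT) ff.
rewrite sub0r cmodN; move: Br; rewrite ltr_pdivrMr// => Br.
rewrite -ltr_sqr ?nnegrE ?cmod_ge0 ?(ltW e0)// expr2.
apply: (le_lt_trans ff); rewrite -[ltRHS]lnK ?posrE ?exprn_gt0// ltr_expR.
by rewrite mulrC; lra.
Qed.

Lemma paired_decay_defect theta delta c B : entire f ->
  paired_decay f theta delta c B -> (0 < defect_at_0 f)%E.
Proof.
move=> entf [[d0 h1 h2 c0] By hN hf].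
apply: (defect_gt0 entf d0 h1 h2 c0 _ hf).
move/cvgryPgt : By => /(_ 0) By.
by apply: filterS2 By hN => r Br Nr; split.
Qed.

Lemma min_modulus_cvg0 theta :
  f (circle_point r theta) @[r --> +oo] --> (0 : R[i]^o) ->
  min_modulus f r @[r --> +oo] --> (0 : R).
Proof.
move=> /cvg_cmod; rewrite cmod0 => ray.
apply: (squeeze_cvgr _ (cvg_cst 0) ray).
apply: (@near_pinfty_gt _ _ 0) => r r0.
have mem : [set cmod (f z) | z in [set z | cmod z = r]] (cmod (f (circle_point r theta))).
  by exists (circle_point r theta) => //; rewrite /mkset cmod_circle_point gtr0_norm.
have lb : lbound [set cmod (f z) | z in [set z | cmod z = r]] 0.
  by move=> _ [z _ <-]; exact: cmod_ge0.
apply/andP; split; first by apply: lb_le_inf => //; eexists; exact: mem.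
by apply: ge_inf => //; exists 0.
Qed.

(** If x_n -> +oo then g(x_n) -> 0, whereas g(x_n) = x_(n+1) -> +oo. *)
Lemma iterates_not_cvg_pinfty (g : R -> R) (r : R) :
  g x @[x --> +oo] --> (0 : R) -> ~ (iter n g r @[n --> \oo] --> +oo).
Proof.
move=> g0 gy.
have small : \forall n \near \oo, g (iter n g r) < 1.
  by apply: (cvgr_lt _ (cvg_comp _ _ gy g0)).
have large : \forall n \near \oo, 1 < iter n g r by move/cvgryPgt : gy => /(_ 1).
have [N1 _ sN] := small; have [N2 _ lN] := large.
have := sN (maxn N1 N2) (leq_maxl _ _).
have := lN (maxn N1 N2).+1 (leqW (leq_maxr _ _)).
by rewrite iterS => /lt_trans h /h; rewrite ltxx.
Qed.

End Consequences.

Local Close Scope complex_scope.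

Theorem theorem4p1 (R : realType) (f : R[i] -> R[i])
    (f_transcendental : transcendental_entire f)
    (f_finite_order : (growth_order f < +oo)%E)
    (f_real_zeros : forall z : R[i], f z = 0 -> complex.Im z = 0)
    (f_genus : (2 <= genus f)%N) :
  let a := exists2 theta : R, 0 <= theta <= 2 * pi &
             f (circle_point r theta) @[r --> +oo] --> (0 : R[i]^o) in
  let b := (0 < defect_at_0 f)%E in
  let m_to_0 := min_modulus f r @[r --> +oo] --> (0 : R) in
  [/\ a, b, a -> m_to_0, b -> m_to_0 &
      m_to_0 /\
      ~ (exists2 r : R, 0 < r &
           iter n (min_modulus f) r @[n --> \oo] --> +oo)].
Proof.
move=> a b m_to_0.
have [theta [delta [c [B decay]]]] := paired_decay_genus_ge2 f_real_zeros f_genus.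
have ray : f (circle_point r theta) @[r --> +oo] --> (0 : R[i]^o).
  exact: paired_decay_cvg0 decay.
have m0 : m_to_0 by exact: min_modulus_cvg0 ray.
split=> //.
- exists theta => //; case: decay => -[? ? ? _] _ _ _.
  by apply/andP; split; lra.
- by apply: paired_decay_defect decay; case: f_transcendental.
- by split=> // -[r _]; exact: iterates_not_cvg_pinfty.
Qed.
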